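(* Let $n\ge2$, let $\Omega\subset\mathbb{C}$ be a domain containing $0$, let $f:\Omega\to\mathbb{C}$ be analytic, and put $\alpha=f(0)$. Let $A,X\in\mathcal{M}_n(\mathbb{C})$ be such that $\sigma(XA-AX)\subset\Omega$ and $f(XA-AX)=X$. Then there exists a nilpotent matrix $N$ such that $X=\alpha I_n+N$, $NA-AN$ is nilpotent, and $$\sum_{k=1}^{n-1}\frac{f^{(k)}(0)}{k!}(NA-AN)^k=N.$$ Moreover, if $f'(0)\neq0$, then there exist a ball $\mathcal{B}$ containing $\alpha$ and an analytic function $g$ defined on $\mathcal{B}$ such that $g'(\alpha)\neq0$ and $$NA-AN=\sum_{k=1}^{n-1}\frac{g^{(k)}(\alpha)}{k!}N^k,$$ and the derivatives $(g^{(k)}(\alpha))_{1\le k\le n-1}$ are explicitly computable quotients (rational expressions) of the derivatives $(f^{(k)}(0))_{1\le k\le n-1}$.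
   Context: For a matrix $M\in\mathcal{M}_n(\mathbb{C})$ with spectrum $\sigma(M)\subset\Omega$, $f(M)$ is the primary matrix function $f(M)=\frac{1}{2i\pi}\int_{\Gamma}f(z)(zI_n-M)^{-1}dz$, where $\Gamma$ is a counterclockwise oriented closed contour in $\Omega$ enclosing $\sigma(M)$ (holomorphic functional calculus). *)

(* Defs.v *)
(* MathComp-Analysis over R[i], the complex field of an arbitrary realType. *)
From HB Require Import structures.
From mathcomp Require Import all_boot all_order all_algebra.
From mathcomp Require Import all_classical all_reals all_analysis.
From mathcomp Require Import complex.
(* Not imported: its notations clash with those of MathComp-Analysis. *)
From mathcomp Require mpoly.

Set Implicit Arguments.
Unset Strict Implicit.
Unset Printing Implicit Defensive.

Import Order.TTheory GRing.Theory Num.Theory.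
Import numFieldNormedType.Exports.

Local Open Scope classical_set_scope.
Local Open Scope ring_scope.
Local Open Scope complex_scope.

(* R[i] bundled as a numFieldType: the library puts the modulus topology and the
   structure of a normed module over itself on the sort of a numFieldType, not on
   the bare type R[i].  Hence open, ball, derive1, derive1n on Cplx R refer to the
   modulus and to complex differentiation. *)
Definition Cplx (R : realType) : numFieldType := R[i].

Section Analytic.
Variable R : realType.
Implicit Types (f : Cplx R -> Cplx R) (D : set (Cplx R)).

(* Functions are total; for open D, analyticity on D does not depend on the
   values taken off D. *)
Definition analytic_at f (z0 : Cplx R) :=
  exists a : nat -> Cplx R,
    \forall z \near z0, series (fun k => a k * (z - z0) ^+ k) @ \oo --> f z.

Definition analytic_on D f := forall z, D z -> analytic_at f z.

End Analytic.

Section Contours.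
Variable R : realType.
Implicit Types (p : R -> Cplx R) (h : Cplx R -> Cplx R).

(* Paths are parametrized by [0, 1].  Asking for C^1 regularity on the whole
   line loses nothing, as a C^1 map on [0, 1] extends to a C^1 map on R, and it
   makes the two-sided derivatives at 0 and 1 meaningful. *)
Definition C1_path p :=
  [/\ forall t, derivable (fun s => complex.Re (p s)) t 1,
      forall t, derivable (fun s => complex.Im (p s)) t 1,
      continuous (derive1 (fun s => complex.Re (p s))) &
      continuous (derive1 (fun s => complex.Im (p s)))].

Definition path_deriv p (t : R) : Cplx R :=
  derive1 (fun s => complex.Re (p s)) t +i*
  derive1 (fun s => complex.Im (p s)) t.

Definition path_integral h p : Cplx R :=
  (\int[lebesgue_measure]_(t in `[0%R, 1%R])
      complex.Re (h (p t) * path_deriv p t)) +i*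
  (\int[lebesgue_measure]_(t in `[0%R, 1%R])
      complex.Im (h (p t) * path_deriv p t)).

(* A closed contour is piecewise C^1: m arcs, each one starting where the
   previous one ends; ordS is the cyclic successor on 'I_m. *)
Definition closed_contour m (Gamma : 'I_m -> R -> Cplx R) :=
  (forall j, C1_path (Gamma j)) /\
  (forall j, Gamma j 1 = Gamma (ordS j) 0).

Definition contour_integral h m (Gamma : 'I_m -> R -> Cplx R) : Cplx R :=
  \sum_(j < m) path_integral h (Gamma j).

Definition two_i_pi : Cplx R := 0 +i* (2 * pi).

Definition winding m (Gamma : 'I_m -> R -> Cplx R) (a : Cplx R) : Cplx R :=
  two_i_pi^-1 * contour_integral (fun z => (z - a)^-1) Gamma.

(* Gamma is a closed contour in Omega which encloses S counterclockwise: it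
   avoids S and turns exactly once around each point of S.  The last clause says
   that Gamma surrounds no point of the complement of Omega; it is what "enclosing
   within Omega" means when Omega is not simply connected.  When Omega is a domain
   and S is a finite subset of it, such a contour always exists. *)
Definition encloses_in (Omega S : set (Cplx R)) m (Gamma : 'I_m -> R -> Cplx R) :=
  [/\ closed_contour Gamma,
      forall j (t : R), 0 <= t <= 1 -> (Omega `\` S) (Gamma j t),
      forall a, S a -> winding Gamma a = 1 &
      forall a, ~ Omega a -> winding Gamma a = 0].

End Contours.

Section MatrixFunctions.
Variables (R : realType) (n : nat).
Implicit Types M Y : 'M[Cplx R]_n.

Definition spectrum M : set (Cplx R) := [set a | eigenvalue M a].

Definition nilpotent_mx M := exists k : nat, M ^+ k = 0.

Definition cauchy_mx (f : Cplx R -> Cplx R) M m (Gamma : 'I_m -> R -> Cplx R) :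
    'M[Cplx R]_n :=
  (two_i_pi R)^-1 *:
  \matrix_(i, j) contour_integral (fun z => f z * invmx (z%:M - M) i j) Gamma.

(* f(M) = Y.  By Cauchy's theorem the value of the integral does not depend on
   the admissible contour, so Y is unique. *)
Definition is_mxfun (Omega : set (Cplx R)) (f : Cplx R -> Cplx R) M Y :=
  exists m (Gamma : 'I_m -> R -> Cplx R),
    encloses_in Omega (spectrum M) Gamma /\ cauchy_mx f M Gamma = Y.

End MatrixFunctions.

(* Value at a point of (Cplx R)^m of a polynomial in m variables with rational
   coefficients. *)
Definition eval_rat (R : realType) m (x : 'I_m -> Cplx R)
    (p : mpoly.mpoly m rat) : Cplx R :=
  mpoly.mmap (@ratr (Cplx R)) x p.

(* Main.v *)
Require Import Defs.
From mathcomp Require Import all_boot all_order all_algebra.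
From mathcomp Require Import all_classical all_reals all_analysis.
From mathcomp Require Import complex.
From mathcomp Require mpoly.
From mathcomp Require Import ring lra.
Import Order.TTheory GRing.Theory Num.Theory.
Import numFieldNormedType.Exports.
Local Open Scope classical_set_scope.
Local Open Scope ring_scope.
Local Open Scope complex_scope.

Set Implicit Arguments.
Unset Strict Implicit.
Unset Printing Implicit Defensive.

(** Write [B] for [XA - AX] and [M(z)] for the resolvent [(z - B)^-1].  Being an
    integral of multiples of [M(z)], the matrix [X = f(B)] commutes with [B], so
    [B] is a bracket [XA - AX] that commutes with [X].  By Jacobson's lemma
    ([jacobson_nilpotent]) such a bracket is nilpotent: bracketing with [A] acts
    on the polynomials in [X] as a derivation, and differentiating the
    Cayley-Hamilton identity until a nonzero constant remains shows that a power
    of [B] vanishes.  Hence [B^n = 0], the spectrum of [B] is [{0}], and the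
    resolvent is the finite sum of the [z^-(k+1) B^k].  Cauchy's formulas
      [\oint f(w) w^-(k+1) dw = 2 i pi f^(k)(0) / k!]
    then turn [X = f(B)] into the truncated Taylor expansion of [f] at [0]
    evaluated at [B] ([mxfun_nilpotent]); removing its constant term gives [N],
    and [NA - AN = XA - AX = B].

    The contour is an arbitrary closed contour in [Omega] with the prescribed
    winding numbers, so Cauchy's formulas are needed in homological form
    ([cauchy_formula]).  The proof is Dixon's.  Integrating the difference
    quotient [(f(w) - f(z)) / (w - z)] along the contour defines a function of
    [z] in [Omega], which agrees with the Cauchy integral of [f] where the
    winding number vanishes.  As it vanishes near every point outside [Omega], the
    two functions together form an entire function, [dixon].  It tends to [0] at infinity, hence vanishes
    ([entire_vanishing], which rests on the maximum principle only), and so do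
    its Taylor coefficients at [0].  These are the contour integrals of the
    divided Taylor remainders of [f] at [0] ([contour_integral_trem]), which is
    an equivalent form of Cauchy's formulas.  Analyticity is handled throughout by
    explicit bounds on the Taylor remainders ([taylor]): such bounds are stable
    under contour integration and under differentiation.

    For the last assertion, [N = p(B)] where [p] is the Taylor polynomial of [f]
    without its constant term.  When [f'(0)] is nonzero, the coefficients of a
    polynomial [q] with [q(p(T)) = T] modulo [T^n] solve a triangular linear
    system whose matrix contains the coefficients of the powers of [p]; Cramer's
    rule writes them as quotients of polynomials in the derivatives of [f]
    ([inv_coef], [power_inversion]).  Only the Taylor coefficients of [g] of order
    less than [n] matter, so [g] can be taken to be the polynomial
    [q(z - f(0))]. *)

(** * Modulus and continuity in the complex field *)

Section Modulus.
Variable R : realType.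
Implicit Types (x y z w : Cplx R).

(** The modulus as an element of [R] rather than of [Cplx R]: real numbers are
    totally ordered. *)
Definition nrm z : R := complex.Re `|z|.

Lemma nrmE z : `|z| = (nrm z)%:C :> Cplx R.
Proof. by rewrite /nrm normc_def. Qed.

Lemma nrm_ge0 z : 0 <= nrm z.
Proof. by rewrite -ler0c -nrmE normr_ge0. Qed.

Lemma nrm0 : nrm 0 = 0.
Proof. by rewrite /nrm normr0. Qed.

Lemma nrm1 : nrm 1 = 1.
Proof. by rewrite /nrm normr1. Qed.

Lemma nrmM x y : nrm (x * y) = nrm x * nrm y.
Proof. by apply: complexI; rewrite rmorphM -!nrmE; exact: normrM. Qed.

Lemma nrmX x k : nrm (x ^+ k) = nrm x ^+ k.
Proof. by elim: k => [|k IH]; rewrite ?expr0 ?nrm1// !exprS nrmM IH. Qed.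

Lemma nrmV x : nrm (x^-1) = (nrm x)^-1.
Proof. by apply: complexI; rewrite fmorphV -!nrmE; exact: normfV. Qed.

Lemma nrmN x : nrm (- x) = nrm x.
Proof. by rewrite /nrm normrN. Qed.

Lemma nrmC x y : nrm (x - y) = nrm (y - x).
Proof. by rewrite -nrmN opprB. Qed.

Lemma nrmD x y : nrm (x + y) <= nrm x + nrm y.
Proof. by rewrite -lecR rmorphD/= -!nrmE; exact: ler_normD. Qed.

Lemma nrmB x y : nrm (x - y) <= nrm x + nrm y.
Proof. by rewrite -(nrmN y); exact: nrmD. Qed.

Lemma nrmBr x y : nrm x - nrm y <= nrm (x - y).
Proof. by have := nrmD (x - y) y; rewrite subrK; lra. Qed.

Lemma nrm_eq0 x : (nrm x == 0) = (x == 0).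
Proof.
apply/eqP/eqP => [nx|->]; last exact: nrm0.
by apply/eqP; rewrite -normr_eq0; apply/eqP; rewrite [LHS]nrmE nx.
Qed.

Lemma nrm_gt0 x : (0 < nrm x) = (x != 0).
Proof. by rewrite lt_def nrm_ge0 andbT nrm_eq0. Qed.

Lemma nrm_sum (I : Type) (s : seq I) (P : pred I) (F : I -> Cplx R) :
  nrm (\sum_(i <- s | P i) F i) <= \sum_(i <- s | P i) nrm (F i).
Proof.
elim/big_ind2: _ => [|x1 x2 y1 y2 h1 h2|//]; first by rewrite nrm0.
exact: le_trans (nrmD _ _) (lerD h1 h2).
Qed.

Lemma nrm_Re z : `|complex.Re z| <= nrm z.
Proof. by rewrite -lecR -nrmE; exact: normc_ge_Re. Qed.

Lemma nrm_Im z : `|complex.Im z| <= nrm z.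
Proof.
have := nrm_Re (z * 'i); rewrite ReiNIm normrN nrmM.
by rewrite [nrm 'i](_ : _ = 1) ?mulr1// /nrm normc_def /= expr0n expr1n /= add0r sqrtr1.
Qed.

Lemma nrm_real (r : R) : nrm (r%:C) = `|r|.
Proof. by rewrite /nrm normc_def /= expr0n /= addr0 sqrtr_sqr. Qed.

Lemma nrm_ReIm z : nrm z <= `|complex.Re z| + `|complex.Im z|.
Proof.
rewrite {1}(complexE z); apply: le_trans (nrmD _ _) _.
rewrite nrmM !nrm_real.
by rewrite [nrm 'i](_ : _ = 1) ?mul1r// /nrm normc_def /= expr0n expr1n /= add0r sqrtr1.
Qed.

Lemma near_nrm z0 (P : Cplx R -> Prop) :
  (\forall z \near z0, P z) <->
  exists2 e : R, 0 < e & forall z, nrm (z - z0) < e -> P z.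
Proof.
split.
  move=> /nbhs_ballP[e /= e0 he].
  have eE : e = (complex.Re e)%:C by rewrite RRe_real// ger0_real// ltW.
  move: e0 he; rewrite eE ltcR => e0 he; exists (complex.Re e) => // z hz.
  apply: he; rewrite -ball_normE /ball_ /= distrC.
  by rewrite nrmE ltcR.
move=> [e e0 he]; apply/nbhs_ballP; exists e%:C => /=; first by rewrite ltcR.
move=> z; rewrite -ball_normE /ball_ /= distrC nrmE ltcR.
exact: he.
Qed.

Lemma cvg_nrm (T : Type) (F : set_system T) {FF : Filter F}
    (h : T -> Cplx R) l :
  h x @[x --> F] --> l <->
  forall e : R, 0 < e -> \forall x \near F, nrm (h x - l) < e.
Proof.
split=> [/cvgrPdist_lt H e e0|H].
  have := H e%:C; rewrite ltcR => /(_ e0); apply: filterS => x.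
  by rewrite distrC nrmE ltcR.
apply/cvgrPdist_lt => e e0.
have eE : e = (complex.Re e)%:C by rewrite RRe_real// ger0_real// ltW.
move: e0; rewrite eE ltcR => /H; apply: filterS => x.
by rewrite distrC nrmE ltcR.
Qed.

Lemma cvg_at_nrm h z0 l :
  h x @[x --> z0] --> l <->
  forall e : R, 0 < e ->
    exists2 d : R, 0 < d & forall z, nrm (z - z0) < d -> nrm (h z - l) < e.
Proof.
split=> [/(cvg_nrm (FF := nbhs_filter z0)) H e /H|H].
  by move/(near_nrm z0 (fun z => nrm (h z - l) < e)).
apply/(cvg_nrm (FF := nbhs_filter z0)) => e /H ?.
exact/(near_nrm z0 (fun z => nrm (h z - l) < e)).
Qed.

(** Continuity of a complex function at a point. *)
Definition cont_at (h : Cplx R -> Cplx R) z : Prop := h x @[x --> z] --> h z.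

Lemma cont_at_cst c z : cont_at (fun=> c) z.
Proof. by apply/cvg_at_nrm => e e0; exists 1 => // y _; rewrite subrr nrm0. Qed.

Lemma cont_at_id z : cont_at id z.
Proof. by apply/cvg_at_nrm => e e0; exists e. Qed.

Lemma cont_atD f g z : cont_at f z -> cont_at g z ->
  cont_at (fun x => f x + g x) z.
Proof. exact: (@cvgD (Cplx R) (Cplx R) _ (nbhs z) _ f g). Qed.

Lemma cont_atB f g z : cont_at f z -> cont_at g z ->
  cont_at (fun x => f x - g x) z.
Proof. exact: (@cvgB (Cplx R) (Cplx R) _ (nbhs z) _ f g). Qed.

Lemma cont_atM f g z : cont_at f z -> cont_at g z ->
  cont_at (fun x => f x * g x) z.
Proof. exact: (@cvgM (Cplx R) _ (nbhs z) _ f g). Qed.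

Lemma cont_atV f z : f z != 0 -> cont_at f z -> cont_at (fun x => (f x)^-1) z.
Proof. exact: (@cvgV (Cplx R) _ (nbhs z) _ f). Qed.

Lemma cont_atX f z k : cont_at f z -> cont_at (fun x => f x ^+ k) z.
Proof.
move=> cf; elim: k => [|k IH].
  by have := @cont_at_cst 1 z; congr cont_at; apply/funext => x; rewrite expr0.
have := cont_atM cf IH; congr cont_at; apply/funext => x; by rewrite exprS.
Qed.

Lemma cont_at_sum (I : Type) (s : seq I) (F : I -> Cplx R -> Cplx R) z :
  (forall i, cont_at (F i) z) -> cont_at (fun x => \sum_(i <- s) F i x) z.
Proof.
move=> H; elim: s => [|i s IH].
  have := @cont_at_cst 0 z; congr cont_at; apply/funext => x; by rewrite big_nil.
have := cont_atD (H i) IH; congr cont_at.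
by apply/funext => x; rewrite big_cons.
Qed.

Lemma cont_at_near f g z : f z = g z ->
  (\forall x \near z, f x = g x) -> cont_at f z -> cont_at g z.
Proof.
move=> fz /near_nrm[d d0 fg] /cvg_at_nrm H; apply/cvg_at_nrm => e /H[d' d'0 Hd].
exists (Num.min d d') => [|x]; first by rewrite lt_min d0.
by rewrite lt_min => /andP[/fg <- /Hd]; rewrite fz.
Qed.

(** A function is continuous at a point towards which it satisfies a Lipschitz
    bound. *)
Lemma cont_at_lipschitz (h : Cplx R -> Cplx R) z0 (C d : R) : 0 < d ->
  (forall z, nrm (z - z0) <= d -> nrm (h z - h z0) <= C * nrm (z - z0)) ->
  cont_at h z0.
Proof.
move=> d0 H; apply/cvg_at_nrm => e e0.
have C0 : 0 < `|C| + 1 by rewrite ltr_wpDl.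
exists (Num.min d (e / (`|C| + 1))); first by rewrite lt_min d0 divr_gt0.
move=> z; rewrite lt_min => /andP[zd]; rewrite ltr_pdivlMr// => ze.
apply: le_lt_trans (H _ (ltW zd)) _; apply: le_lt_trans ze.
rewrite mulrC ler_wpM2l ?nrm_ge0//; apply: le_trans (ler_norm _) _.
by rewrite lerDl.
Qed.

End Modulus.

(** * Taylor expansions with uniform remainder bounds *)

Section Taylor.
Variable R : realType.
Implicit Types (z w : Cplx R) (f : Cplx R -> Cplx R) (a : nat -> Cplx R).
Implicit Types (C rho : R).

(** The polynomial of degree less than [K] in [w - z0] with coefficients [a]. *)
Definition tpoly a z0 (K : nat) w := \sum_(k < K) a k * (w - z0) ^+ k.

(** Divided Taylor remainder [(f - tpoly) / (w - z0)^K], extended by [a K] at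
    [z0], which is its limit when [a] lists the Taylor coefficients of [f]. *)
Definition trem f z0 a (K : nat) w :=
  if w == z0 then a K else (f w - tpoly a z0 K w) / (w - z0) ^+ K.

(** [f] has a Taylor expansion at [z0] with coefficients [a], in the quantitative
    form [|f w - tpoly a z0 K w| <= C (|w - z0| / rho)^K] for all [K] and all [w]
    in the closed disc of radius [rho].  This is equivalent to analyticity at [z0]
    ([analytic_taylor], [taylor_analytic]) and involves no limit. *)
Definition taylor f z0 a C rho := 0 < rho /\
  forall w K, nrm (w - z0) <= rho ->
    nrm (f w - tpoly a z0 K w) * rho ^+ K <= C * nrm (w - z0) ^+ K.

Lemma tpoly0 a z0 w : tpoly a z0 0 w = 0.
Proof. by rewrite /tpoly big_ord0. Qed.

Lemma tpolyS a z0 K w : tpoly a z0 K.+1 w = tpoly a z0 K w + a K * (w - z0) ^+ K.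
Proof. by rewrite /tpoly big_ord_recr. Qed.

Lemma taylor_ge0 f z0 a C rho : taylor f z0 a C rho -> 0 <= C.
Proof.
move=> [r0 /(_ z0 0%N)]; rewrite subrr nrm0 !expr0 !mulr1 => /(_ (ltW r0)).
exact/le_trans/nrm_ge0.
Qed.

Lemma taylor_at f z0 a C rho : taylor f z0 a C rho -> f z0 = a 0%N.
Proof.
move=> [r0 /(_ z0 1%N)]; rewrite subrr nrm0 => /(_ (ltW r0)).
rewrite expr1 expr1 mulr0 tpolyS tpoly0 add0r expr0 mulr1 => H.
have : nrm (f z0 - a 0%N) <= 0.
  by rewrite -(ler_pM2r r0) mul0r.
by rewrite le_eqVlt ltNge nrm_ge0 orbF nrm_eq0 subr_eq0 => /eqP.
Qed.

Lemma taylor_shrink f z0 a C rho rho' : taylor f z0 a C rho ->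
  0 < rho' -> rho' <= rho -> taylor f z0 a C rho'.
Proof.
move=> [r0 H] r0' le; split=> // w K wr.
have := H w K (le_trans wr le); apply: le_trans.
by rewrite ler_wpM2l ?nrm_ge0// lerXn2r// nnegrE ltW.
Qed.

Lemma taylor_coef f z0 a C rho K : taylor f z0 a C rho ->
  nrm (a K) * rho ^+ K <= 2 * C.
Proof.
move=> [r0 H]; pose w := z0 + rho%:C.
have wE : w - z0 = rho%:C by rewrite /w addrC addKr.
have nw : nrm (w - z0) = rho by rewrite wE nrm_real gtr0_norm.
have rK k : 0 < rho ^+ k by rewrite exprn_gt0.
have HK : forall k, nrm (f w - tpoly a z0 k w) <= C.
  by move=> k; have := H w k; rewrite nw ler_pM2r// lexx; apply.
have -> : nrm (a K) * rho ^+ K = nrm (a K * (w - z0) ^+ K).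
  by rewrite nrmM nrmX nw.
have -> : a K * (w - z0) ^+ K =
    (f w - tpoly a z0 K w) - (f w - tpoly a z0 K.+1 w).
  by rewrite tpolyS; ring.
by apply: le_trans (nrmB _ _) _; have := HK K; have := HK K.+1; lra.
Qed.

Lemma trem0 f z0 a w : f z0 = a 0%N -> trem f z0 a 0 w = f w.
Proof.
by rewrite /trem tpoly0 subr0 expr0 divr1; case: eqP => [->|].
Qed.

Lemma tremS f z0 a K w : f z0 = a 0%N ->
  (w - z0) * trem f z0 a K.+1 w = trem f z0 a K w - a K.
Proof.
move=> f0; rewrite /trem; case: eqP => [->|/eqP wz]; first by rewrite !subrr mul0r.
have wz' : w - z0 != 0 by rewrite subr_eq0.
rewrite tpolyS exprS; field.
by rewrite wz' expf_neq0.
Qed.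

Lemma trem_expand f z0 a K w : f z0 = a 0%N ->
  f w = tpoly a z0 K w + (w - z0) ^+ K * trem f z0 a K w.
Proof.
move=> f0; elim: K => [|K IH]; first by rewrite tpoly0 add0r expr0 mul1r trem0.
rewrite IH tpolyS exprSr -mulrA tremS//; ring.
Qed.

Lemma trem_bound f z0 a C rho K w : taylor f z0 a C rho ->
  nrm (w - z0) <= rho -> nrm (trem f z0 a K w) * rho ^+ K <= 2 * C.
Proof.
move=> tf wr; rewrite /trem; case: eqP => [_|/eqP wz]; first exact: taylor_coef tf.
have wz' : 0 < nrm (w - z0) by rewrite nrm_gt0 subr_eq0.
case: (tf) => r0 /(_ w K wr) H.
rewrite nrmM nrmV nrmX mulrAC ler_pdivrMr ?exprn_gt0//.
apply: le_trans H _; rewrite ler_wpM2r ?exprn_ge0 ?nrm_ge0//.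
by have := taylor_ge0 tf; lra.
Qed.

Lemma trem_continuous_at f z0 a C rho K : taylor f z0 a C rho ->
  cont_at (trem f z0 a K) z0.
Proof.
move=> tf; have [r0 _] := tf; have fz := taylor_at tf.
apply: (@cont_at_lipschitz _ _ _ (2 * C / rho ^+ K.+1) rho) => // w wr.
have -> : trem f z0 a K z0 = a K by rewrite /trem eqxx.
rewrite -tremS// nrmM mulrC ler_wpM2r ?nrm_ge0// ler_pdivlMr ?exprn_gt0//.
exact: trem_bound tf wr.
Qed.

Lemma taylor_continuous f z0 a C rho : taylor f z0 a C rho ->
  cont_at f z0.
Proof.
move=> tf; have := trem_continuous_at (K := 0) tf.
by congr cont_at; apply/funext => x; rewrite (trem0 _ (taylor_at tf)).
Qed.

Lemma taylor_derive1 f z0 a C rho : taylor f z0 a C rho ->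
  derive1 f z0 = a 1%N.
Proof.
move=> tf; have f0 := taylor_at tf.
apply: cvg_lim => //.
apply/cvg_nrm => e e0.
have := trem_continuous_at (K := 1) tf.
move=> /cvg_at_nrm /(_ e e0) [d d0 Hd].
near=> h.
have h0 : h != 0 by near: h; exact: nbhs_dnbhs_neq.
have hd : nrm h < d.
  near: h; apply: (@nbhs_dnbhs _ 0); apply/near_nrm; exists d => // z.
  by rewrite subr0.
have := Hd (h + z0); rewrite addrK => /(_ hd).
rewrite /trem eqxx.
rewrite (_ : h + z0 == z0 = false); last first.
  by apply/negbTE; rewrite -subr_eq0 addrK.
by rewrite tpolyS tpoly0 add0r expr0 mulr1 expr1 addrK -f0 mulrC.
Unshelve. all: by end_near. Qed.

(** The tails of a series dominated by a geometric one of ratio at most 1/2. *)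
Lemma geom_sum_le (u : nat -> Cplx R) (D x : R) K L : 0 <= x -> x <= 2^-1 ->
  (forall k, nrm (u k) <= D * x ^+ k) -> 0 <= D ->
  nrm (\sum_(k < K + L) u k - \sum_(k < K) u k) <= 2 * D * x ^+ K.
Proof.
move=> x0 x2 H D0.
suff : nrm (\sum_(k < K + L) u k - \sum_(k < K) u k) <=
    2 * D * x ^+ K * (1 - 2^-1 ^+ L).
  move/le_trans; apply; rewrite ler_piMr ?gerBl ?exprn_ge0 ?invr_ge0//.
  by rewrite !mulr_ge0 ?exprn_ge0.
elim: L => [|L IH]; first by rewrite addn0 subrr nrm0 expr0 subrr mulr0.
rewrite addnS big_ord_recr /= addrAC; apply: le_trans (nrmD _ _) _.
apply: le_trans (lerD IH (H _)) _.
have : x ^+ L <= 2^-1 ^+ L by rewrite lerXn2r// nnegrE invr_ge0.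
have : 0 <= D * x ^+ K by rewrite mulr_ge0 ?exprn_ge0.
rewrite exprD exprS; set p := x ^+ K; set q := x ^+ L; set s := 2^-1 ^+ L.
by move=> h1 h2; nra.
Qed.

Lemma half_pow_lt (e : R) : 0 < e -> exists L, (2^-1 : R) ^+ L < e.
Proof.
move=> e0; have /cvgrPdist_lt /(_ _ e0) : (fun n => (2^-1 : R) ^+ n) @ \oo --> 0.
  by apply: cvg_expr; rewrite ger0_norm ?invr_ge0// invf_lt1// ltr1n.
move=> [L _ /(_ L)] /(_ (leqnn _)) /=; rewrite sub0r normrN ger0_norm ?exprn_ge0 ?invr_ge0//.
by exists L.
Qed.

Lemma analytic_taylor f z0 : analytic_at f z0 ->
  exists a C rho, taylor f z0 a C rho.
Proof.
move=> [a /near_nrm[e e0 H]]; exists a.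
(* convergence at one point of modulus r bounds the coefficients; the remainders
   are then controlled on the disc of radius r / 2 *)
pose r := e / 2; have r0 : 0 < r by rewrite divr_gt0.
pose z1 := z0 + r%:C.
have wE : z1 - z0 = r%:C by rewrite /z1 addrC addKr.
have nw : nrm (z1 - z0) = r by rewrite wE nrm_real gtr0_norm.
have /cvgP/cvg_series_cvg_0/cvg_nrm/(_ 1 ltr01) :
    series (fun k => a k * (z1 - z0) ^+ k) @ \oo --> f z1.
  by apply: H; rewrite nw /r; lra.
move=> [K0 _ HK0].
pose M := \sum_(k < K0) nrm (a k * (z1 - z0) ^+ k) + 1.
have M1 : 1 <= M by rewrite lerDr sumr_ge0// => i _; exact: nrm_ge0.
have HM k : nrm (a k) * r ^+ k <= M.
  rewrite -nw -nrmX -nrmM; case: (ltnP k K0) => kK; last first.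
    by have := HK0 k kK; rewrite /= subr0 => /ltW/le_trans; apply.
  rewrite /M (bigD1 (Ordinal kK)) //= -[leRHS]addrA lerDl addr_ge0//.
  by rewrite sumr_ge0// => i _; exact: nrm_ge0.
exists (2 * M), (r / 2); have r20 : 0 < r / 2 by rewrite divr_gt0.
split=> // w K wr.
pose x := nrm (w - z0) / r.
have x0 : 0 <= x by rewrite divr_ge0 ?nrm_ge0// ltW.
have x2 : x <= 2^-1 by rewrite ler_pdivrMr// mulrC.
have Hu k : nrm (a k * (w - z0) ^+ k) <= M * x ^+ k.
  rewrite nrmM nrmX /x expr_div_n mulrA ler_pdivlMr ?exprn_gt0//.
  by rewrite mulrAC ler_wpM2r ?exprn_ge0 ?nrm_ge0.
have B : nrm (f w - tpoly a z0 K w) <= 2 * M * x ^+ K.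
  apply/ler_addgt0Pr => eps eps0.
  have /cvg_nrm/(_ _ eps0) : series (fun k => a k * (w - z0) ^+ k) @ \oo --> f w.
    by apply: H; apply: le_lt_trans wr _; rewrite /r; lra.
  move=> [L _ /(_ (K + L)%N)] /(_ (leq_addl _ _)) /=.
  rewrite /series /= big_mkord => /ltW hL.
  have -> : f w - tpoly a z0 K w =
     (\sum_(k < K + L) a k * (w - z0) ^+ k - tpoly a z0 K w) -
     (\sum_(k < K + L) a k * (w - z0) ^+ k - f w) by ring.
  apply: le_trans (nrmB _ _) _; apply: lerD hL.
  apply: (geom_sum_le (u := fun k => a k * (w - z0) ^+ k)) => //.
  by apply: le_trans M1.
apply: le_trans (ler_wpM2r (exprn_ge0 _ (ltW r20)) B) _.
rewrite -[leLHS]mulrA ler_wpM2l ?mulr_ge0//; first by apply: le_trans M1.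
have xr : x * (r / 2) <= nrm (w - z0).
  have -> : x * (r / 2) = nrm (w - z0) / 2.
    by rewrite /x; field; rewrite gt_eqF.
  by rewrite ler_pdivrMr// ler_peMr ?nrm_ge0// ler1n.
rewrite -exprMn lerXn2r ?nnegrE ?nrm_ge0//.
exact: mulr_ge0 x0 (ltW r20).
Qed.

Lemma taylor_analytic f z0 a C rho : taylor f z0 a C rho -> analytic_at f z0.
Proof.
move=> tf; have [r0 H] := tf; have C0 := taylor_ge0 tf.
exists a; apply/near_nrm; exists (rho / 2); first by rewrite divr_gt0.
move=> w wr; apply/cvg_nrm => e e0.
have e1 : 0 < e / (C + 1) by rewrite divr_gt0 ?ltr_wpDl.
have [L HL] := half_pow_lt e1.
exists L => // K /= LK; rewrite /series /= big_mkord nrmC.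
have := H w K; rewrite (le_trans (ltW wr)); last by rewrite ler_pdivrMr//; lra.
move=> /(_ isT); rewrite -ler_pdivlMr ?exprn_gt0// => h.
apply: le_lt_trans h _; rewrite -mulrA -expr_div_n.
apply: (@le_lt_trans _ _ (C * (2^-1) ^+ L)).
  rewrite ler_wpM2l//; apply: (@le_trans _ _ (2^-1 ^+ K)).
    rewrite lerXn2r ?nnegrE ?divr_ge0 ?nrm_ge0 ?(ltW r0)//.
    by rewrite ler_pdivrMr// mulrC ltW.
  by rewrite ler_wiXn2l// invf_le1 ?ler1n.
rewrite ltr_pdivlMr ?ltr_wpDl// in HL.
apply: le_lt_trans HL; rewrite mulrC ler_wpM2l ?exprn_ge0//.
by rewrite lerDl.
Qed.

End Taylor.

(** * Expansion of difference quotients and term by term differentiation *)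

Section Kernel.
Variable R : realType.
Implicit Types (z w : Cplx R) (f : Cplx R -> Cplx R) (a b : nat -> Cplx R).
Implicit Types (C rho : R).

Lemma trem_continuous f z0 a K w : w != z0 -> f z0 = a 0%N ->
  cont_at f w -> cont_at (trem f z0 a K) w.
Proof.
move=> wz f0 cf; elim: K => [|K IH].
  by move: cf; congr cont_at; apply/funext => x; rewrite trem0.
have remE y : y != z0 -> (trem f z0 a K y - a K) / (y - z0) = trem f z0 a K.+1 y.
  by move=> yz; rewrite -tremS// mulrAC mulfV ?mul1r// subr_eq0.
apply: (cont_at_near (f := fun y => (trem f z0 a K y - a K) / (y - z0))).
- exact: remE.
- apply/near_nrm; exists (nrm (w - z0)); first by rewrite nrm_gt0 subr_eq0.
  by move=> y yw; apply: remE; apply: contraTneq yw => ->; rewrite nrmC ltxx.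
- apply: cont_atM; first by apply: cont_atB IH _; exact: cont_at_cst.
  apply: cont_atV; first by rewrite subr_eq0.
  by apply: cont_atB; [exact: cont_at_id | exact: cont_at_cst].
Qed.

(** Away from [z0] the divided remainders are still of geometric growth, because
    [trem K.+1] is [(trem K - a K) / (w - z0)] and the
    [a K (rho / 2)^K] are summable. *)
Lemma trem_bound_all f z0 a C rho H K w : taylor f z0 a C rho ->
  nrm (f w) <= H -> nrm (trem f z0 a K w) * (rho / 2) ^+ K <= H + 4 * C.
Proof.
move=> tf fH; have C0 := taylor_ge0 tf; have [r0 _] := tf.
have f0 := taylor_at tf.
have H0 : 0 <= H by apply: le_trans fH; exact: nrm_ge0.
have r20 : 0 < rho / 2 by rewrite divr_gt0.
have [wr|wr] := leP (nrm (w - z0)) (rho / 2).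
  apply: le_trans (trem_bound K (taylor_shrink tf r20 _) wr) _; lra.
have Ha k : nrm (a k) * (rho / 2) ^+ k <= 2 * C * 2^-1 ^+ k.
  rewrite exprMn mulrA ler_wpM2r ?exprn_ge0 ?invr_ge0//; exact: taylor_coef tf.
(* the error term 1 - 2^-K makes the bound inductive *)
suff : nrm (trem f z0 a K w) * (rho / 2) ^+ K <= H + 4 * C * (1 - 2^-1 ^+ K).
  move/le_trans; apply; rewrite lerD2l ler_piMr ?gerBl ?exprn_ge0 ?invr_ge0//.
  by rewrite mulr_ge0.
elim: K => [|K IH]; first by rewrite trem0// expr0 mulr1 expr0 subrr mulr0 addr0.
have : nrm ((w - z0) * trem f z0 a K.+1 w) * (rho / 2) ^+ K <=
    H + 4 * C * (1 - 2^-1 ^+ K) + 2 * C * 2^-1 ^+ K.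
  rewrite tremS//; apply: le_trans (lerD IH (Ha K)).
  by rewrite -mulrDl ler_wpM2r ?nrmB// exprn_ge0// ltW.
have -> : H + 4 * C * (1 - 2^-1 ^+ K) + 2 * C * 2^-1 ^+ K =
  H + 4 * C * (1 - 2^-1 ^+ K.+1) by rewrite exprS; field.
apply: le_trans; rewrite nrmM exprS mulrA ler_wpM2r ?exprn_ge0 ?(ltW r20)//.
by rewrite mulrC ler_wpM2r ?nrm_ge0// ltW.
Qed.

Lemma kernel_telescope (r a : nat -> Cplx R) (u v : Cplx R) K :
  (forall k, u * r k.+1 = r k - a k) ->
  (u - v) * \sum_(k < K) r k.+1 * v ^+ k =
  r 0%N - \sum_(k < K) a k * v ^+ k - r K * v ^+ K.
Proof.
move=> H; elim: K => [|K IH]; first by rewrite !big_ord0 mulr0 expr0; ring.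
rewrite !big_ord_recr /= mulrDr IH mulrBl mulrA H exprS; ring.
Qed.

(** If a sequence [r] of remainders satisfies [u r_(k+1) = r_k - a_k], then
    [(r_0 - s) / (u - v)] is the sum of the power series with coefficients
    [r_(k+1)] in [v], where [s] is the sum of the series with coefficients [a]. *)
Lemma kernel_bound (r a : nat -> Cplx R) (s u v : Cplx R) C rho K :
  0 < rho -> (forall k, u * r k.+1 = r k - a k) ->
  (forall k, nrm (r k) * rho ^+ k <= C) ->
  (forall k, nrm (s - \sum_(j < k) a j * v ^+ j) * rho ^+ k <= C * nrm v ^+ k) ->
  nrm v <= rho / 2 -> u != v ->
  nrm ((r 0%N - s) / (u - v) - \sum_(k < K) r k.+1 * v ^+ k) * rho ^+ K.+1
    <= 2 * C * nrm v ^+ K.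
Proof.
move=> r0 Hr Hb Hs vr uv.
have C0 : 0 <= C.
  by have := Hb 0%N; rewrite expr0 mulr1; apply: le_trans; exact: nrm_ge0.
have uv0 : u - v != 0 by rewrite subr_eq0.
have nuv : 0 < nrm (u - v) by rewrite nrm_gt0.
pose x := nrm v / rho.
have x0 : 0 <= x by rewrite divr_ge0 ?nrm_ge0// ltW.
have x2 : x <= 2^-1 by rewrite ler_pdivrMr// mulrC.
pose E L := (r 0%N - s) / (u - v) - \sum_(k < L) r k.+1 * v ^+ k.
have EE L : (u - v) * E L = r L * v ^+ L - (s - \sum_(k < L) a k * v ^+ k).
  rewrite /E mulrBr (kernel_telescope v L Hr) mulrC divfK//; ring.
(* the tail E L tends to 0, at a rate depending on u - v *)
have HE L : nrm (u - v) * nrm (E L) <= 2 * C * x ^+ L.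
  rewrite -nrmM EE; apply: le_trans (nrmB _ _) _.
  rewrite nrmM nrmX /x expr_div_n mulrA ler_pdivlMr ?exprn_gt0// mulrDl.
  rewrite mulrAC; have := ler_wpM2r (exprn_ge0 L (nrm_ge0 v)) (Hb L).
  by have := Hs L; lra.
(* the terms are dominated by a geometric series, uniformly in u *)
have Hu k : nrm (r k.+1 * v ^+ k) <= C / rho * x ^+ k.
  have -> : C / rho * x ^+ k = C * nrm v ^+ k / rho ^+ k.+1.
    by rewrite /x expr_div_n exprS; field; rewrite ?expf_neq0 gt_eqF.
  rewrite nrmM nrmX ler_pdivlMr ?exprn_gt0// mulrAC ler_wpM2r//.
  by rewrite exprn_ge0 ?nrm_ge0.
suff B : nrm (E K) <= 2 * (C / rho) * x ^+ K.
  have -> : 2 * C * nrm v ^+ K = 2 * (C / rho) * x ^+ K * rho ^+ K.+1.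
    by rewrite /x expr_div_n exprS; field; rewrite ?expf_neq0 gt_eqF.
  by rewrite ler_wpM2r// exprn_ge0// ltW.
apply/ler_addgt0Pr => e e0.
have e1 : 0 < e * nrm (u - v) / (2 * C + 1).
  by rewrite divr_gt0 ?mulr_gt0//; lra.
have [L HL] := half_pow_lt e1.
have -> : E K = (\sum_(k < K + L) r k.+1 * v ^+ k - \sum_(k < K) r k.+1 * v ^+ k)
   + E (K + L)%N by rewrite /E; ring.
apply: le_trans (nrmD _ _) _; apply: lerD.
  apply: (geom_sum_le (u := fun k => r k.+1 * v ^+ k)) => //.
  by rewrite divr_ge0// ltW.
rewrite -(ler_pM2l nuv); apply: le_trans (HE _) _.
move: HL; rewrite ltr_pdivlMr; last by lra.
have : x ^+ (K + L) <= 2^-1 ^+ L.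
  apply: (@le_trans _ _ (2^-1 ^+ (K + L))).
    by rewrite lerXn2r// nnegrE invr_ge0.
  by rewrite ler_wiXn2l// ?leq_addl// invf_le1 ?ler1n.
have : 0 <= (2^-1 : R) ^+ L by rewrite exprn_ge0 ?invr_ge0.
set p := 2^-1 ^+ L; set q := x ^+ _ => p0 qp h.
have h2 : C * q <= C * p by rewrite ler_wpM2l.
by nra.
Qed.

(** A bound that holds off a point extends to it by continuity. *)
Lemma nrm_le_of_near (h : Cplx R -> Cplx R) z M d :
  cont_at h z -> 0 < d ->
  (forall w, w != z -> nrm (w - z) < d -> nrm (h w) <= M) -> nrm (h z) <= M.
Proof.
move=> /cvg_at_nrm ch d0 H; apply/ler_addgt0Pr => e e0.
have [d' d'0 Hd'] := ch e e0.
pose t := Num.min d d' / 2.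
have m0 : 0 < Num.min d d' by rewrite lt_min d0.
have t0 : 0 < t by rewrite divr_gt0.
have tm : t < Num.min d d' by rewrite /t; lra.
have wE : z + t%:C - z = t%:C by rewrite addrC addKr.
have nw : nrm (z + t%:C - z) = t by rewrite wE nrm_real gtr0_norm.
move: tm; rewrite lt_min -nw => /andP[/H hd /Hd' hd'].
have {}hd : nrm (h (z + t%:C)) <= M.
  by apply: hd; rewrite -subr_eq0 -nrm_eq0 nw gt_eqF.
have -> : h z = h (z + t%:C) - (h (z + t%:C) - h z) by ring.
by apply: le_trans (nrmB _ _) _; lra.
Qed.

Lemma trem_continuousP f z0 a C rho K w : taylor f z0 a C rho ->
  cont_at f w -> cont_at (trem f z0 a K) w.
Proof.
move=> tf cf; have [->|wz] := eqVneq w z0; first exact: trem_continuous_at tf.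
exact: trem_continuous (taylor_at tf) cf.
Qed.

(** [diff_quotient_taylor] off the diagonal.  There [trem f z b 1 w] is
    the difference quotient of [f] between [w] and [z], whatever [b 1]. *)
Lemma diff_quotient_taylor_off f z0 z a b C rho H K w :
  taylor f z0 a C rho -> f z = b 0%N -> nrm (z - z0) <= rho / 4 ->
  nrm (f w) <= H -> w != z ->
  nrm (trem f z b 1 w - \sum_(k < K) trem f z0 a k.+1 w * (z - z0) ^+ k)
    * (rho / 2) ^+ K.+1 <= 2 * (H + 4 * C) * nrm (z - z0) ^+ K.
Proof.
move=> tf fz zr fH wz; have [r0 tb] := tf; have f0 := taylor_at tf.
have C0 := taylor_ge0 tf.
have H0 : 0 <= H by apply: le_trans fH; exact: nrm_ge0.
have -> : trem f z b 1 w = (trem f z0 a 0 w - f z) / ((w - z0) - (z - z0)).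
  rewrite /trem (negbTE wz) tpolyS !tpoly0 add0r !expr0 expr1 mulr1 -fz subr0.
  by rewrite divr1 opprB addrA subrK; case: eqP => // ->; rewrite f0.
apply: (kernel_bound (r := fun k => trem f z0 a k w) (a := a)) => //.
- by rewrite divr_gt0.
- by move=> k; rewrite tremS.
- by move=> k; exact: trem_bound_all.
- move=> k; have [] := taylor_shrink tf (rho' := rho / 2).
  + by rewrite divr_gt0.
  + by lra.
  + move=> _ /(_ z k); rewrite (le_trans zr); last by lra.
    move=> /(_ isT) /le_trans; apply; rewrite ler_wpM2r ?exprn_ge0 ?nrm_ge0//.
    by lra.
- by apply: le_trans zr _; lra.
- by rewrite -subr_eq0 opprB addrA subrK subr_eq0.
Qed.

(** Taylor expansion in the base point [z] of the difference quotient of [f]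
    between [w] and [z]: its coefficients are the values at [w] of the divided
    Taylor remainders of [f].  The diagonal [w = z] is reached by continuity. *)
Lemma diff_quotient_taylor f z0 z a b C C' rho rho' H K w :
  taylor f z0 a C rho -> taylor f z b C' rho' -> nrm (z - z0) <= rho / 4 ->
  nrm (f w) <= H ->
  nrm (trem f z b 1 w - \sum_(k < K) trem f z0 a k.+1 w * (z - z0) ^+ k)
    * (rho / 2) ^+ K.+1 <= 2 * (H + 5 * C) * nrm (z - z0) ^+ K.
Proof.
move=> tf tz zr fH; have C0 := taylor_ge0 tf; have [r0 tb] := tf.
have H0 : 0 <= H by apply: le_trans fH; exact: nrm_ge0.
have vK : 0 <= nrm (z - z0) ^+ K by rewrite exprn_ge0 ?nrm_ge0.
have r20 : 0 < (rho / 2) ^+ K.+1 by rewrite exprn_gt0 ?divr_gt0.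
have [->|wz] := eqVneq w z; last first.
  apply: le_trans (diff_quotient_taylor_off K tf (taylor_at tz) zr fH wz) _.
  by rewrite ler_wpM2r//; lra.
rewrite -ler_pdivlMr//.
apply: (@nrm_le_of_near
  (fun w => trem f z b 1 w - \sum_(k < K) trem f z0 a k.+1 w * (z - z0) ^+ k)
  z _ (rho / 4)).
- apply: cont_atB; first exact: trem_continuous_at tz.
  apply: (cont_at_sum (F := fun (k : 'I_K) x => trem f z0 a k.+1 x * (z - z0) ^+ k)) => k.
  apply: cont_atM; last exact: cont_at_cst.
  exact: trem_continuousP tf (taylor_continuous tz).
- by rewrite divr_gt0.
- move=> y yz yr; rewrite ler_pdivlMr//.
  have yH : nrm (f y) <= C.
    have := tb y 0%N; rewrite tpoly0 subr0 !expr0 !mulr1; apply.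
    have -> : y - z0 = (y - z) + (z - z0) by ring.
    by apply: le_trans (nrmD _ _) _; lra.
  apply: le_trans (diff_quotient_taylor_off K tf (taylor_at tz) zr yH yz) _.
  by rewrite ler_wpM2r//; lra.
Qed.

(** At [w] itself, the expansion of the difference quotient is, up to a remainder,
    the series of the derivative. *)
Lemma sum_trem f z0 a w K : f z0 = a 0%N ->
  \sum_(k < K) trem f z0 a k.+1 w * (w - z0) ^+ k =
  \sum_(k < K) k.+1%:R * a k.+1 * (w - z0) ^+ k
    + K%:R * (w - z0) ^+ K * trem f z0 a K.+1 w.
Proof.
move=> f0; elim: K => [|K IH]; first by rewrite !big_ord0 !mul0r addr0.
rewrite !big_ord_recr /= {}IH; set S := \sum_(i < K) _.
have := tremS K.+1 w f0; set t2 := trem _ _ _ K.+2 _; set t1 := trem _ _ _ K.+1 _.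
move=> t21; rewrite exprSr -!mulrA t21 -natr1; ring.
Qed.

(** Term by term differentiation. *)
Lemma taylor_deriv f z0 a C rho : taylor f z0 a C rho ->
  (forall z, nrm (z - z0) <= rho / 4 -> exists b C' rho', taylor f z b C' rho') ->
  taylor (derive1 f) z0 (fun k => k.+1%:R * a k.+1) (28 * C / rho) (rho / 4).
Proof.
move=> tf tD; have [r0 tb] := tf; have f0 := taylor_at tf.
have C0 := taylor_ge0 tf.
split=> [|z K zr]; first by rewrite divr_gt0.
have [b [C' [rho' tz]]] := tD z zr.
have fC : nrm (f z) <= C.
  by have := tb z 0%N; rewrite tpoly0 subr0 !expr0 !mulr1; apply; lra.
have := diff_quotient_taylor K tf tz zr fC.
have -> : trem f z b 1 z = derive1 f z by rewrite /trem eqxx (taylor_derive1 tz).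
rewrite sum_trem// -/(tpoly (fun k => k.+1%:R * a k.+1) z0 K z) => B.
have zr' : nrm (z - z0) <= rho by apply: le_trans zr _; lra.
have B2 := trem_bound K.+1 tf zr'.
move: B B2; set S := tpoly _ _ _ _; set t := trem _ _ _ _ _.
set v := z - z0 => B B2.
have vK : 0 <= nrm v ^+ K by rewrite exprn_ge0 ?nrm_ge0.
(* the factor K is absorbed by halving the radius, as K <= 2^K *)
have B3 : nrm (K%:R * v ^+ K * t) * (rho / 2) ^+ K.+1 <= 2 * C * nrm v ^+ K.
  have nK : nrm (K%:R : Cplx R) = K%:R.
    rewrite [X in nrm X](_ : _ = (K%:R)%:C); last by rewrite rmorph_nat.
    by rewrite nrm_real ger0_norm.
  rewrite !nrmM nrmX nK exprMn.
  have -> : K%:R * nrm v ^+ K * nrm t * (rho ^+ K.+1 * 2^-1 ^+ K.+1) =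
    (nrm t * rho ^+ K.+1) * (nrm v ^+ K * (K%:R * 2^-1 ^+ K.+1)) by ring.
  apply: ler_pM => //.
  - by rewrite mulr_ge0 ?nrm_ge0 ?exprn_ge0// ltW.
  - by apply: mulr_ge0 => //; apply: mulr_ge0 => //; rewrite exprn_ge0 ?invr_ge0.
  - rewrite ler_piMr// exprVn ler_pdivrMr ?exprn_gt0// mul1r -natrX ler_nat.
    by apply: leq_trans (ltnW (ltn_expl K (ltnSn 1))) _; rewrite leq_exp2l.
have B4 : nrm (derive1 f z - S) * (rho / 2) ^+ K.+1 <= 14 * C * nrm v ^+ K.
  have -> : derive1 f z - S = (derive1 f z - (S + K%:R * v ^+ K * t)) +
     K%:R * v ^+ K * t by ring.
  apply: (@le_trans _ _ ((nrm (derive1 f z - (S + K%:R * v ^+ K * t)) +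
     nrm (K%:R * v ^+ K * t)) * (rho / 2) ^+ K.+1)).
    by rewrite ler_wpM2r ?nrmD// exprn_ge0// divr_ge0// ltW.
  by rewrite mulrDl; nra.
have r20 : 0 < rho / 2 by rewrite divr_gt0.
apply: (@le_trans _ _ (nrm (derive1 f z - S) * (rho / 2) ^+ K)).
  rewrite ler_wpM2l ?nrm_ge0// lerXn2r// ?nnegrE ?ltW// ?divr_gt0//; lra.
rewrite -(ler_pM2r r20) -[leLHS]mulrA -exprSr; apply: le_trans B4 _.
rewrite le_eqVlt; apply/orP; left; apply/eqP; field; by rewrite gt_eqF.
Qed.

(** If [f] has Taylor expansions at all points of an open set, its
    derivatives of order [k] there are [k!] times the Taylor coefficients. *)
Lemma taylor_derive1n (D : set (Cplx R)) f : open D ->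
  (forall z, D z -> exists b C rho, taylor f z b C rho) ->
  forall z a C rho k, D z -> taylor f z a C rho ->
  derive1n k f z = (k`!)%:R * a k.
Proof.
move=> oD fD z a C rho k Dz tf.
suff [C' [rho' tk]] : exists C' rho', taylor (derive1n k f) z
    (fun j => ((j + k) ^_ k)%:R * a (j + k)%N) C' rho'.
  by rewrite (taylor_at tk) add0n ffactnn.
have tD g : (forall z, D z -> exists b C rho, taylor g z b C rho) ->
  forall z b C rho, D z -> taylor g z b C rho -> exists C' rho',
    taylor (derive1 g) z (fun k => k.+1%:R * b k.+1) C' rho'.
  move=> gD y b C1 r1 Dy ty.
  have [e e0 He] : exists2 e : R, 0 < e & forall w, nrm (w - y) < e -> D w.
    by apply/near_nrm; exact: open_nbhs_nbhs.
  have [r10 _] := ty.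
  pose r2 := Num.min r1 e; have r20 : 0 < r2 by rewrite lt_min r10.
  have ty2 : taylor g y b C1 r2 by apply: taylor_shrink ty _ _; rewrite ?ge_min ?lexx.
  eexists; eexists; apply: (taylor_deriv ty2) => w wy.
  apply: gD; apply: He; apply: le_lt_trans wy _.
  have : r2 <= e by rewrite ge_min lexx orbT.
  by lra.
(* (i + j) ^_ j is the factor acquired by X^(i+j) in j differentiations *)
have gen j : (forall z, D z -> exists b C rho, taylor (derive1n j f) z b C rho) /\
  exists C' rho', taylor (derive1n j f) z
    (fun i => ((i + j) ^_ j)%:R * a (i + j)%N) C' rho'.
  elim: j => [|j [IH1 [C1 [r1 IH2]]]].
    split=> //; exists C, rho; move: tf; congr taylor; apply/funext => i.
    by rewrite addn0 ffactn0 mul1r.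
  rewrite derive1nS; split.
    move=> y Dy; have [b [C2 [r2 ty]]] := IH1 _ Dy.
    have [C3 [r3 ty3]] := tD _ IH1 _ _ _ _ Dy ty.
    by exists (fun k => k.+1%:R * b k.+1), C3, r3.
  have [C3 [r3 ty3]] := tD _ IH1 _ _ _ _ Dz IH2.
  exists C3, r3; move: ty3; congr taylor; apply/funext => i.
  rewrite mulrA -natrM addSnnS; congr (_%:R * _).
  by rewrite ffactnSr -addSnnS addnK mulnC.
exact: (gen k).2.
Qed.

End Kernel.

(** * Maximum principle *)

Section Maximum.
Variable R : realType.
Implicit Types (z w : Cplx R) (G : Cplx R -> Cplx R) (a : nat -> Cplx R).

Lemma taylor_cst G z0 a C rho : taylor G z0 a C rho ->
  (forall k, (0 < k)%N -> a k = 0) ->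
  forall w, nrm (w - z0) <= rho / 2 -> G w = G z0.
Proof.
move=> tG a0 w wr; have [r0 tb] := tG; have C0 := taylor_ge0 tG.
have G0 := taylor_at tG.
have tpE K : tpoly a z0 K.+1 w = a 0%N.
  elim: K => [|K IH]; rewrite tpolyS; first by rewrite tpoly0 add0r expr0 mulr1.
  by rewrite IH (a0 K.+1)// mul0r addr0.
apply/eqP; rewrite G0 -subr_eq0 -nrm_eq0; apply/eqP/le_anti; rewrite nrm_ge0 andbT.
apply/ler_addgt0Pr => e e0; rewrite add0r.
have e1 : 0 < e / (C + 1) by rewrite divr_gt0 ?ltr_wpDl.
have [L HL] := half_pow_lt e1.
have wr1 : nrm (w - z0) <= rho by apply: le_trans wr _; lra.
have := tb w L.+1 wr1; rewrite tpE.
have : C * nrm (w - z0) ^+ L.+1 <= C * (rho / 2) ^+ L.+1.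
  by rewrite ler_wpM2l// lerXn2r ?nnegrE ?nrm_ge0// divr_ge0// ltW.
have -> : C * (rho / 2) ^+ L.+1 = C * 2^-1 ^+ L.+1 * rho ^+ L.+1.
  by rewrite exprMn; ring.
move=> h1 h2; have := le_trans h2 h1; rewrite ler_pM2r ?exprn_gt0// => h3.
apply: le_trans h3 _; move: HL; rewrite ltr_pdivlMr ?ltr_wpDl// => HL.
have p0 : 0 <= (2^-1 : R) ^+ L by rewrite exprn_ge0 ?invr_ge0.
by rewrite exprS; nra.
Qed.

(** Maximum principle: where the modulus has a nonzero local maximum, the function
    is locally constant. *)
Lemma local_max_cst G z0 a C rho (d : R) : taylor G z0 a C rho -> 0 < d ->
  (forall w, nrm (w - z0) < d -> nrm (G w) <= nrm (G z0)) -> G z0 != 0 ->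
  forall w, nrm (w - z0) <= rho / 2 -> G w = G z0.
Proof.
move=> tG d0 Hmax Gz0; have [r0 tb] := tG; have C0 := taylor_ge0 tG.
have G0 := taylor_at tG.
apply: (taylor_cst tG) => k.
move=> k0; apply/eqP/negPn/negP => ak.
have exk : exists k, (0 < k)%N && (a k != 0) by exists k; rewrite k0.
case: (ex_minnP exk) => m /andP[m0 am] minm {k k0 ak exk}.
have tpE j : (0 < j <= m)%N -> tpoly a z0 j =1 fun=> a 0%N.
  move=> + y; elim: j => // -[|j] IH jm; rewrite tpolyS.
    by rewrite tpoly0 add0r expr0 mulr1.
  rewrite IH; last by rewrite /= ltnW//; case/andP: jm.
  have -> : a j.+1 = 0.
    apply/eqP/negPn/negP => aj; have := minm j.+1; rewrite aj /= => /(_ isT).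
    by case/andP: jm => _ /leq_trans h /h; rewrite ltnn.
  by rewrite mul0r addr0.
(* a direction in which the first two nonzero terms add up *)
pose zeta : Cplx R := m.-root (a 0%N / a m : R[i]).
have zm : a m * zeta ^+ m = a 0%N.
  by rewrite /zeta rootCK// mulrC divfK.
have a00 : a 0%N != 0 by rewrite -G0.
have na0 : 0 < nrm (a 0%N) by rewrite nrm_gt0.
have nz : 0 < nrm zeta.
  rewrite nrm_gt0; apply: contraNneq a00 => z00; rewrite -zm z00 expr0n.
  by rewrite (gtn_eqF m0) mulr0.
pose D := C * nrm zeta ^+ m.+1 / rho ^+ m.+1.
have D0 : 0 <= D.
  by rewrite !mulr_ge0 ?invr_ge0 ?exprn_ge0 ?nrm_ge0// ltW.
have step (t : R) : 0 < t -> t * nrm zeta < d -> t * nrm zeta <= rho ->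
    nrm (a 0%N) <= D * t.
  move=> t0 td tr; pose y := z0 + t%:C * zeta.
  have yE : y - z0 = t%:C * zeta by rewrite /y addrC addKr.
  have ny : nrm (y - z0) = t * nrm zeta by rewrite yE nrmM nrm_real gtr0_norm.
  have tpy : tpoly a z0 m.+1 y = a 0%N * (1 + t ^+ m)%:C.
    rewrite tpolyS tpE ?m0 ?leqnn// yE exprMn mulrCA zm rmorphD rmorph1 rmorphXn /=.
    by ring.
  have := Hmax y; rewrite ny G0 => /(_ td) hG.
  have := tb y m.+1; rewrite ny => /(_ tr).
  rewrite -ler_pdivlMr ?exprn_gt0// => hR.
  have : nrm (tpoly a z0 m.+1 y) <= nrm (a 0%N) + D * t ^+ m.+1.
    have -> : tpoly a z0 m.+1 y = G y - (G y - tpoly a z0 m.+1 y) by ring.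
    apply: le_trans (nrmB _ _) (lerD hG _); apply: le_trans hR _.
    rewrite le_eqVlt; apply/orP; left; apply/eqP.
    by rewrite /D exprMn; field; rewrite expf_neq0// gt_eqF.
  rewrite tpy nrmM nrm_real ger0_norm ?addr_ge0 ?exprn_ge0 ?(ltW t0)//.
  rewrite mulrDr mulr1 lerD2l exprSr mulrA mulrAC.
  by rewrite ler_pM2r ?exprn_gt0.
pose t := Num.min (Num.min d rho / (2 * nrm zeta)) (nrm (a 0%N) / (2 * (D + 1))).
have md0 : 0 < Num.min d rho by rewrite lt_min d0.
have t0 : 0 < t.
  by rewrite lt_min !divr_gt0 ?mulr_gt0 ?ltr_wpDl.
have t1 : t * nrm zeta < Num.min d rho.
  have : t <= Num.min d rho / (2 * nrm zeta) by rewrite ge_min lexx.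
  rewrite ler_pdivlMr ?mulr_gt0// => h; nra.
move: t1; rewrite lt_min => /andP[td tr].
have := step t t0 td (ltW tr).
have : t <= nrm (a 0%N) / (2 * (D + 1)) by rewrite ge_min lexx orbT.
rewrite ler_pdivlMr ?mulr_gt0 ?ltr_wpDl// => h1 h2; nra.
Qed.

Lemma compact_square (M : R) :
  compact [set z : Cplx R | complex.Re z \in `[-M, M] /\ complex.Im z \in `[-M, M]].
Proof.
pose h (p : R * R) : Cplx R := p.1 +i* p.2.
have hc : continuous h.
  move=> [x y]; apply/cvg_nrm => e e0.
  have e2 : 0 < e / 2 by rewrite divr_gt0.
  near=> p.
  apply: le_lt_trans (nrm_ReIm _) _ => /=.
  have h1 : `|p.1 - x| < e / 2.
    near: p; have : (fun p : R * R => p.1) q @[q --> (x, y)] --> x by exact: cvg_fst.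
    by move=> /cvgrPdist_lt/(_ _ e2); apply: filterS => q; rewrite distrC.
  have h2 : `|p.2 - y| < e / 2.
    near: p; have : (fun p : R * R => p.2) q @[q --> (x, y)] --> y by exact: cvg_snd.
    by move=> /cvgrPdist_lt/(_ _ e2); apply: filterS => q; rewrite distrC.
  lra.
have -> : [set z : Cplx R | complex.Re z \in `[-M, M] /\ complex.Im z \in `[-M, M]]
   = h @` ([set` `[-M, M]] `*` [set` `[-M, M]]).
  apply/seteqP; split=> [[x y] [/= hx hy]|z [[x y] [/= hx hy] <-]//].
  by exists (x, y).
apply: continuous_compact; first exact: continuous_subspaceT.
by apply: compact_setX; exact: segment_compact.
Unshelve. all: by end_near. Qed.

Lemma nrm_continuous G : continuous G -> continuous (fun z => nrm (G z)).
Proof.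
move=> cG z; have /cvg_at_nrm H := cG z; apply/(@cvgrPdist_lt _ _ _ _ (nbhs_filter z)) => e e0.
have [d d0 Hd] := H e e0; apply/near_nrm; exists d => // w /Hd h.
rewrite distrC; apply: le_lt_trans h; rewrite ler_norml.
have := nrmBr (G w) (G z); have := nrmBr (G z) (G w); rewrite (nrmC (G z)); lra.
Qed.

Lemma Re_continuous : continuous (fun z : Cplx R => complex.Re z).
Proof.
move=> z; apply/(@cvgrPdist_lt _ _ _ _ (nbhs_filter z)) => e e0; apply/near_nrm; exists e => // w h.
rewrite distrC; apply: le_lt_trans h; rewrite -raddfB; exact: nrm_Re.
Qed.

(** Liouville's theorem for functions vanishing at infinity, by the maximum
    principle. *)
Lemma entire_vanishing G :
  (forall z, exists a C rho, taylor G z a C rho) ->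
  (forall e : R, 0 < e -> exists M : R, forall z, M <= nrm z -> nrm (G z) < e) ->
  forall z, G z = 0.
Proof.
move=> tG Ginf z1; apply/eqP/negPn/negP => Gz1.
have cG : continuous G.
  by move=> z; have [a [C [rho /taylor_continuous]]] := tG z.
have [M0 HM0] := Ginf _ (eqbRL (nrm_gt0 _) Gz1).
pose A : set (Cplx R) :=
  [set z | complex.Re z \in `[-M0, M0] /\ complex.Im z \in `[-M0, M0]].
have outA z : ~ A z -> nrm (G z) < nrm (G z1).
  move=> nA; apply: HM0; rewrite leNgt; apply/negP => zM; apply: nA.
  have hR := le_lt_trans (nrm_Re z) zM; have hI := le_lt_trans (nrm_Im z) zM.
  by split; rewrite in_itv /= -ler_norml ltW.
have Az1 : A z1 by apply: contrapT => /outA; rewrite ltxx.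
have cA : compact A by exact: compact_square.
have [c cinA cmax] := compact_EVT_max (ex_intro _ _ Az1) cA
  (continuous_subspaceT (nrm_continuous cG)).
have cmax' z : nrm (G z) <= nrm (G c).
  have [Az|/outA/ltW] := pselect (A z); first by apply: cmax; rewrite inE.
  by move=> /le_trans; apply; apply: cmax; rewrite inE.
(* among the points where |G| is maximal, one with maximal real part *)
pose B := A `&` [set z | nrm (G z) = nrm (G c)].
have cB : compact B.
  apply: compact_closedI => //.
  have := @closed_comp _ _ (fun z => nrm (G z)) [set nrm (G c)].
  apply; first by move=> ? _; exact: nrm_continuous.
  exact: closed_eq.
have Bc : B c by split => //; rewrite -inE.
have [b] := compact_EVT_max (ex_intro _ _ Bc) cB
  (continuous_subspaceT Re_continuous).
rewrite inE => -[Ab Gb] bmax.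
have [a [C [rho tb]]] := tG b; have [r0 _] := tb.
have Gb0 : G b != 0.
  by rewrite -nrm_gt0 Gb; apply: lt_le_trans (cmax' z1); rewrite nrm_gt0.
have r20 : 0 < rho / 2 by rewrite divr_gt0.
pose w := b + (rho / 2)%:C.
have Gw : G w = G b.
  apply: (local_max_cst tb ltr01 _ Gb0); first by move=> ? _; rewrite Gb.
  by rewrite /w addrC addKr nrm_real gtr0_norm.
have Bw : B w.
  split; last by rewrite /= Gw.
  by apply: contrapT => /outA; rewrite Gw Gb ltNge cmax'.
(* w also attains the maximum and lies to the right of b *)
have := bmax w; rewrite inE => /(_ Bw); rewrite /w raddfD /=.
lra.
Qed.

End Maximum.

(** * Integrals of complex functions of a real variable *)

Section PathIntegral.
Variable R : realType.
Implicit Types (p q : R -> Cplx R) (h g : Cplx R -> Cplx R) (t : R).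

Local Notation mu := (@lebesgue_measure R).
Local Notation I01 := [set` `[0 : R, 1 : R]].

(** Continuity on [[0, 1]], two-sided at the endpoints. *)
Definition cont01 (u : R -> R) := forall t, 0 <= t <= 1 -> {for t, continuous u}.

Lemma cont01_within u : cont01 u -> {within `[0, 1], continuous u}.
Proof.
move=> cu; apply: continuous_in_subspaceT => t.
by rewrite inE /= in_itv /= => /cu.
Qed.

Lemma cont01_integrable u : cont01 u -> mu.-integrable I01 (EFin \o u).
Proof.
move=> cu; apply: continuous_compact_integrable; first exact: segment_compact.
exact: cont01_within.
Qed.

Lemma cont01D u v : cont01 u -> cont01 v -> cont01 (fun t => u t + v t).
Proof. by move=> cu cv t t01; apply: continuousD; [exact: cu | exact: cv]. Qed.

Lemma cont01B u v : cont01 u -> cont01 v -> cont01 (fun t => u t - v t).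
Proof. by move=> cu cv t t01; apply: continuousB; [exact: cu | exact: cv]. Qed.

Lemma cont01M u v : cont01 u -> cont01 v -> cont01 (fun t => u t * v t).
Proof. by move=> cu cv t t01; apply: continuousM; [exact: cu | exact: cv]. Qed.

Lemma cont01_cst c : cont01 (fun=> c).
Proof. by move=> t _; exact: cst_continuous. Qed.

Lemma cont01_bounded u : cont01 u -> exists M : R, forall t, 0 <= t <= 1 -> u t <= M.
Proof.
move=> cu; have [c _ Hc] := EVT_max ler01 (cont01_within cu).
by exists (u c) => t t01; apply: Hc; rewrite in_itv.
Qed.

Definition cont01C q :=
  cont01 (fun t => complex.Re (q t)) /\ cont01 (fun t => complex.Im (q t)).

Lemma ReM (x y : Cplx R) : complex.Re (x * y) =
  complex.Re x * complex.Re y - complex.Im x * complex.Im y.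
Proof. by case: x y => [a b] [c d]. Qed.

Lemma ImM (x y : Cplx R) : complex.Im (x * y) =
  complex.Re x * complex.Im y + complex.Im x * complex.Re y.
Proof. by case: x y => [a b] [c d] /=; rewrite addrC. Qed.

Lemma ReD (x y : Cplx R) : complex.Re (x + y) = complex.Re x + complex.Re y.
Proof. by case: x y => [a b] [c d]. Qed.

Lemma ImD (x y : Cplx R) : complex.Im (x + y) = complex.Im x + complex.Im y.
Proof. by case: x y => [a b] [c d]. Qed.

Lemma ReN (x : Cplx R) : complex.Re (- x) = - complex.Re x.
Proof. by case: x => [a b]. Qed.

Lemma ImN (x : Cplx R) : complex.Im (- x) = - complex.Im x.
Proof. by case: x => [a b]. Qed.

Lemma cont01C_M p q : cont01C p -> cont01C q -> cont01C (fun t => p t * q t).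
Proof.
move=> [p1 p2] [q1 q2]; split.
  under eq_fun do rewrite ReM.
  by apply: cont01B; exact: cont01M.
under eq_fun do rewrite ImM.
by apply: cont01D; exact: cont01M.
Qed.

Lemma C1_cont p t : C1_path p ->
  {for t, continuous (fun s => complex.Re (p s))} /\
  {for t, continuous (fun s => complex.Im (p s))}.
Proof.
by case=> dR dI _ _; split; apply: differentiable_continuous; apply/derivable1_diffP.
Qed.

Lemma cont01C_comp p h : C1_path p ->
  (forall t, 0 <= t <= 1 -> cont_at h (p t)) -> cont01C (fun t => h (p t)).
Proof.
move=> Cp ch.
have H t : 0 <= t <= 1 -> forall e : R, 0 < e ->
    \forall s \near t, nrm (h (p s) - h (p t)) < e.
  move=> t01 e e0; have /cvg_at_nrm/(_ e e0)[d d0 Hd] := ch t t01.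
  have [cR cI] := C1_cont t Cp.
  have d2 : 0 < d / 2 by rewrite divr_gt0.
  near=> s; apply: Hd; apply: le_lt_trans (nrm_ReIm _) _.
  rewrite !(ReD, ImD, ReN, ImN).
  have h1 : `|complex.Re (p s) - complex.Re (p t)| < d / 2.
    near: s; move/cvgrPdist_lt: cR => /(_ _ d2); apply: filterS => s.
    by rewrite distrC.
  have h2 : `|complex.Im (p s) - complex.Im (p t)| < d / 2.
    near: s; move/cvgrPdist_lt: cI => /(_ _ d2); apply: filterS => s.
    by rewrite distrC.
  lra.
split=> t t01; apply/cvgrPdist_lt => e e0; have := H t t01 e e0;
  apply: filterS => s hs; rewrite distrC; apply: le_lt_trans hs.
  by have := nrm_Re (h (p s) - h (p t)); rewrite ReD ReN.
by have := nrm_Im (h (p s) - h (p t)); rewrite ImD ImN.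
Unshelve. all: by end_near. Qed.

Lemma cont01C_deriv p : C1_path p -> cont01C (path_deriv p).
Proof. by case=> _ _ cR cI; split => t _; [exact: cR | exact: cI]. Qed.

(** Integral over [[0, 1]] of a complex function. *)
Definition cint q : Cplx R :=
  (\int[mu]_(t in I01) complex.Re (q t)) +i* (\int[mu]_(t in I01) complex.Im (q t)).

Lemma cintD p q : cont01C p -> cont01C q ->
  cint (fun t => p t + q t) = cint p + cint q.
Proof.
move=> [p1 p2] [q1 q2]; apply/eqP; rewrite eq_complex /=; apply/andP; split; apply/eqP.
  under eq_Rintegral do rewrite ReD.
  by rewrite RintegralD//; exact: cont01_integrable.
under eq_Rintegral do rewrite ImD.
by rewrite RintegralD//; exact: cont01_integrable.
Qed.

Lemma cintZ c q : cont01C q -> cint (fun t => c * q t) = c * cint q.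
Proof.
move=> [q1 q2]; have cZ r (u : R -> R) : cont01 u -> cont01 (fun t => r * u t).
  by move=> cu; apply: cont01M => //; exact: cont01_cst.
apply/eqP; rewrite eq_complex /=; apply/andP; split; apply/eqP.
  under eq_Rintegral do rewrite ReM.
  rewrite RintegralB//; try by apply: cont01_integrable; exact: cZ.
  rewrite !RintegralZl//; try exact: cont01_integrable.
  by case: c.
under eq_Rintegral do rewrite ImM.
rewrite RintegralD//; try by apply: cont01_integrable; exact: cZ.
rewrite !RintegralZl//; try exact: cont01_integrable.
by case: c.
Qed.

Lemma Rint_bound (u : R -> R) M : cont01 u -> (forall t, 0 <= t <= 1 -> `|u t| <= M) ->
  `|\int[mu]_(t in I01) u t| <= M.
Proof.
move=> cu uM; apply: le_trans (le_normr_Rintegral _ (cont01_integrable cu)) _ => //.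
have -> : M = \int[mu]_(t in I01) (fun=> M) t.
  have mI : mu I01 = 1%:E by rewrite lebesgue_measure_itv /= lte_fin ltr01 -EFinB subr0.
  rewrite Rintegral_cst// -[LHS]mulr1; congr (_ * _).
  exact: (esym (congr1 fine mI)).
apply: le_Rintegral => //.
- apply: cont01_integrable => t t01; apply: continuous_comp; first exact: cu.
  exact: norm_continuous.
- by apply: cont01_integrable; exact: cont01_cst.
Qed.

(** The factor 2 comes from bounding the real and imaginary parts separately. *)
Lemma cint_bound q M : cont01C q -> (forall t, 0 <= t <= 1 -> nrm (q t) <= M) ->
  nrm (cint q) <= 2 * M.
Proof.
move=> [c1 c2] qM; apply: le_trans (nrm_ReIm _) _.
rewrite mulr2n mulrDl !mul1r; apply: lerD; apply: Rint_bound => // t t01.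
  exact: le_trans (nrm_Re _) (qM t t01).
exact: le_trans (nrm_Im _) (qM t t01).
Qed.

(** [q], a complex function of a real variable, has derivative [d] at [t],
    componentwise. *)
Definition cderiv q t (d : Cplx R) :=
  is_derive t 1 (fun s => complex.Re (q s)) (complex.Re d) /\
  is_derive t 1 (fun s => complex.Im (q s)) (complex.Im d).

Lemma cderiv_path p t : C1_path p -> cderiv p t (path_deriv p t).
Proof.
by move=> [dR dI _ _]; split; rewrite /path_deriv /= derive1E; apply: DeriveDef.
Qed.

Lemma is_deriveMf (u v : R -> R) t a b : is_derive t 1 u a -> is_derive t 1 v b ->
  is_derive t 1 (fun s => u s * v s) (u t * b + v t * a).
Proof. by move=> du dv; exact: is_deriveM. Qed.

Lemma is_deriveDf (u v : R -> R) t a b : is_derive t 1 u a -> is_derive t 1 v b ->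
  is_derive t 1 (fun s => u s + v s) (a + b).
Proof. by move=> du dv; exact: is_deriveD. Qed.

Lemma is_deriveBf (u v : R -> R) t a b : is_derive t 1 u a -> is_derive t 1 v b ->
  is_derive t 1 (fun s => u s - v s) (a - b).
Proof. by move=> du dv; exact: is_deriveB. Qed.

Lemma is_deriveVf (u : R -> R) t a : u t != 0 -> is_derive t 1 u a ->
  is_derive t 1 (fun s => (u s)^-1) (- u t ^- 2 * a).
Proof. by move=> ut du; exact: is_deriveV. Qed.

Lemma cderivM p q t dp dq : cderiv p t dp -> cderiv q t dq ->
  cderiv (fun s => p s * q s) t (dp * q t + p t * dq).
Proof.
move=> [p1 p2] [q1 q2]; split.
  under eq_fun do rewrite ReM.
  apply: (is_derive_eq (is_deriveBf (is_deriveMf p1 q1) (is_deriveMf p2 q2))).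
  rewrite !(ReD, ReM, ImM); ring.
under eq_fun do rewrite ImM.
apply: (is_derive_eq (is_deriveDf (is_deriveMf p1 q2) (is_deriveMf p2 q1))).
rewrite !(ImD, ReM, ImM); ring.
Qed.

Lemma cderiv_cst (c : Cplx R) t : cderiv (fun=> c) t 0.
Proof. by split => /=; exact: is_derive_cst. Qed.

Lemma cderiv_sub p t dp c : cderiv p t dp -> cderiv (fun s => p s - c) t dp.
Proof.
move=> [p1 p2]; split.
  under eq_fun do rewrite ReD.
  by apply: (is_derive_eq (is_deriveDf p1 (is_derive_cst _ _ _))); rewrite addr0.
under eq_fun do rewrite ImD.
by apply: (is_derive_eq (is_deriveDf p2 (is_derive_cst _ _ _))); rewrite addr0.
Qed.

Lemma cderivX p t dp k : cderiv p t dp ->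
  cderiv (fun s => p s ^+ k.+1) t (k.+1%:R * p t ^+ k * dp).
Proof.
move=> hp; elim: k => [|k IH].
  by rewrite expr0 !mul1r; under eq_fun do rewrite expr1.
have := cderivM hp IH; under eq_fun do rewrite -exprS.
congr cderiv; rewrite -[in RHS]natr1 [p t ^+ k.+1]exprS; ring.
Qed.

Lemma cderivV p t dp : cderiv p t dp -> p t != 0 ->
  cderiv (fun s => (p s)^-1) t (- (p t) ^- 2 * dp).
Proof.
move=> [p1 p2] pt0.
pose n s := complex.Re (p s) * complex.Re (p s) + complex.Im (p s) * complex.Im (p s).
have n0 : n t != 0.
  rewrite /n; apply: contra pt0.
  rewrite -!expr2 paddr_eq0 ?sqr_ge0// !sqrf_eq0 => /andP[h1 h2].
  by rewrite eq_complex h1 h2.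
have dn := is_deriveDf (is_deriveMf p1 p1) (is_deriveMf p2 p2).
have dV := is_deriveVf n0 dn.
have RV s : complex.Re (p s)^-1 = complex.Re (p s) * (n s)^-1.
  by rewrite /n -!expr2; case: (p s).
have IV s : complex.Im (p s)^-1 = (- complex.Im (p s)) * (n s)^-1.
  by rewrite /n -!expr2; case: (p s) => a b /=; rewrite mulNr.
split.
  under eq_fun do rewrite RV.
  apply: (is_derive_eq (is_deriveMf p1 dV)).
  rewrite !(ReM, ImM, ReN, ImN, RV, IV, expr2, invfM) /n /=.
  by field.
under eq_fun do rewrite IV.
have p2N := is_deriveBf (is_derive_cst 0 t 1) p2.
have := is_deriveMf p2N dV; under eq_fun do rewrite sub0r.
move=> H; apply: (is_derive_eq H).
rewrite !(ReM, ImM, ReN, ImN, RV, IV, expr2, invfM) /n /=.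
by field.
Qed.

(** Fundamental theorem of calculus. *)
Lemma cint_FTC q dq : (forall t, 0 <= t <= 1 -> cderiv q t (dq t)) ->
  cont01C dq -> cint dq = q 1 - q 0.
Proof.
move=> dqE [c1 c2].
have FTC (u v : R -> R) : (forall t, 0 <= t <= 1 -> is_derive t 1 u (v t)) ->
    cont01 v -> \int[mu]_(t in I01) v t = u 1 - u 0.
  move=> du cv; rewrite /Rintegral (continuous_FTC2 (F := u) ltr01)//.
  - exact: cont01_within.
  - have cu t : 0 <= t <= 1 -> {for t, continuous u}.
      move=> t01; apply: differentiable_continuous; apply/derivable1_diffP.
      by case: (du t t01).
    split=> [t|  |].
    + by rewrite in_itv /= => /andP[h1 h2]; case: (du t) => //; rewrite !ltW.
    + by apply: cvg_at_right_filter; apply: cu; rewrite lexx ler01.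
    + by apply: cvg_at_left_filter; apply: cu; rewrite lexx ler01.
  - move=> t; rewrite in_itv /= => /andP[h1 h2]; rewrite derive1E.
    by case: (du t) => //; rewrite !ltW.
apply/eqP; rewrite eq_complex /= ReD ReN ImD ImN; apply/andP; split; apply/eqP.
  by apply: (FTC (fun t => complex.Re (q t))) => // t t01; case: (dqE t t01).
by apply: (FTC (fun t => complex.Im (q t))) => // t t01; case: (dqE t t01).
Qed.

End PathIntegral.

(** * Contour integrals *)

Section Contour.
Variables (R : realType) (m : nat) (Gamma : 'I_m -> R -> Cplx R).
Implicit Types (f g h : Cplx R -> Cplx R) (z w : Cplx R).

(** The image of the contour. *)
Definition on_trace w := exists (j : 'I_m) (t : R), 0 <= t <= 1 /\ w = Gamma j t.

(** Continuity at the points of the contour, as functions of the complex plane. *)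
Definition cont_on h := forall w, on_trace w -> cont_at h w.

Hypothesis CG : closed_contour Gamma.

Lemma path_integralE h j : path_integral h (Gamma j) =
  cint (fun t => h (Gamma j t) * path_deriv (Gamma j) t).
Proof. by []. Qed.

Lemma cont01C_integrand h j : cont_on h ->
  cont01C (fun t => h (Gamma j t) * path_deriv (Gamma j) t).
Proof.
move=> ch; have Cp := CG.1 j; apply: cont01C_M; last exact: cont01C_deriv.
by apply: cont01C_comp => // t t01; apply: ch; exists j, t.
Qed.

Lemma eq_contour_integral h g : (forall w, on_trace w -> h w = g w) ->
  contour_integral h Gamma = contour_integral g Gamma.
Proof.
move=> hg; apply: eq_bigr => j _; rewrite !path_integralE.
have E t : t \in `[0 : R, 1 : R] -> h (Gamma j t) = g (Gamma j t).
  by rewrite in_itv /= => t01; apply: hg; exists j, t.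
congr (_ +i* _); apply: eq_Rintegral => t; rewrite inE /= => /E -> //.
Qed.

Lemma contour_integralD h g : cont_on h -> cont_on g ->
  contour_integral (fun w => h w + g w) Gamma =
  contour_integral h Gamma + contour_integral g Gamma.
Proof.
move=> ch cg; rewrite /contour_integral -big_split; apply: eq_bigr => j _ /=.
rewrite !path_integralE -cintD; try exact: cont01C_integrand.
by congr cint; apply/funext => t; rewrite mulrDl.
Qed.

Lemma contour_integralZ c h : cont_on h ->
  contour_integral (fun w => c * h w) Gamma = c * contour_integral h Gamma.
Proof.
move=> ch; rewrite /contour_integral mulr_sumr; apply: eq_bigr => j _ /=.
rewrite !path_integralE -cintZ; last exact: cont01C_integrand.
by congr cint; apply/funext => t; rewrite mulrA.
Qed.

Lemma cont_on_cst c : cont_on (fun=> c).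
Proof. by move=> w _; exact: cont_at_cst. Qed.

Lemma cont_onM h g : cont_on h -> cont_on g -> cont_on (fun w => h w * g w).
Proof. by move=> ch cg w Tw; apply: cont_atM; [exact: ch | exact: cg]. Qed.

Lemma cont_onZ c h : cont_on h -> cont_on (fun w => c * h w).
Proof. by apply: cont_onM; exact: cont_on_cst. Qed.

Lemma cont_on_sum (I : Type) (s : seq I) (F : I -> Cplx R -> Cplx R) :
  (forall i, cont_on (F i)) -> cont_on (fun w => \sum_(i <- s) F i w).
Proof. by move=> H w Tw; apply: cont_at_sum => i; exact: H. Qed.

Lemma cont_onB h g : cont_on h -> cont_on g -> cont_on (fun w => h w - g w).
Proof. by move=> ch cg w Tw; apply: cont_atB; [exact: ch | exact: cg]. Qed.

Lemma contour_integral0 : contour_integral (fun=> 0) Gamma = 0.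
Proof.
rewrite -[RHS](mul0r (contour_integral (fun=> 0) Gamma)) -contour_integralZ.
  by apply: eq_contour_integral => w _; rewrite mul0r.
exact: cont_on_cst.
Qed.

Lemma contour_integralB h g : cont_on h -> cont_on g ->
  contour_integral (fun w => h w - g w) Gamma =
  contour_integral h Gamma - contour_integral g Gamma.
Proof.
move=> ch cg.
have -> : contour_integral (fun w => h w - g w) Gamma =
    contour_integral (fun w => h w + (- 1) * g w) Gamma.
  by apply: eq_contour_integral => w _; rewrite mulN1r.
by rewrite (contour_integralD ch (cont_onZ cg)) (contour_integralZ _ cg) mulN1r.
Qed.

Lemma contour_integral_sum (I : Type) (s : seq I) (F : I -> Cplx R -> Cplx R) :
  (forall i, cont_on (F i)) ->
  contour_integral (fun w => \sum_(i <- s) F i w) Gamma =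
  \sum_(i <- s) contour_integral (F i) Gamma.
Proof.
move=> H; elim: s => [|i s IH].
  by rewrite big_nil -[RHS]contour_integral0; apply: eq_contour_integral => w _; rewrite big_nil.
rewrite big_cons -IH -contour_integralD; [|exact: H|exact: cont_on_sum].
by apply: eq_contour_integral => w _; rewrite big_cons.
Qed.

Lemma cont01_nrm1 (q : R -> Cplx R) : cont01C q ->
  exists2 M : R, 0 <= M & forall t, 0 <= t <= 1 -> nrm (q t) <= M.
Proof.
move=> [c1 c2].
have cn (u : R -> R) : cont01 u -> cont01 (fun t => `|u t|).
  move=> cu t t01; apply: continuous_comp; first exact: cu.
  exact: norm_continuous.
have [M HM] := cont01_bounded (cont01D (cn _ c1) (cn _ c2)).
have H t : 0 <= t <= 1 -> nrm (q t) <= M.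
  by move=> t01; exact: le_trans (nrm_ReIm _) (HM t t01).
exists M => //; apply: (le_trans (nrm_ge0 (q 0))).
by apply: H; rewrite lexx ler01.
Qed.

Lemma trace_bounded h : cont_on h ->
  exists2 H : R, 0 <= H & forall w, on_trace w -> nrm (h w) <= H.
Proof.
move=> ch.
have /choice[B HB] : forall j, exists M : R, 0 <= M /\
    forall t, 0 <= t <= 1 -> nrm (h (Gamma j t)) <= M.
  move=> j; have [|M M0 HM] := @cont01_nrm1 (fun t => h (Gamma j t)); last by exists M.
  by apply: cont01C_comp; [exact: CG.1 | move=> t t01; apply: ch; exists j, t].
exists (\sum_j B j); first by apply: sumr_ge0 => j _; case: (HB j).
move=> w [j [t [t01 ->]]]; apply: le_trans ((HB j).2 t t01) _.
by rewrite (bigD1 j)//= lerDl sumr_ge0// => i _; case: (HB i).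
Qed.

(** The constant [L] plays the role of the length of the contour. *)
Lemma contour_integral_bound : exists2 L : R, 0 <= L & forall h M, cont_on h ->
  (forall w, on_trace w -> nrm (h w) <= M) ->
  nrm (contour_integral h Gamma) <= L * M.
Proof.
have /choice[B HB] : forall j, exists M : R, 0 <= M /\
    forall t, 0 <= t <= 1 -> nrm (path_deriv (Gamma j) t) <= M.
  by move=> j; have [M M0 HM] := cont01_nrm1 (cont01C_deriv (CG.1 j)); exists M.
exists (\sum_j 2 * B j).
  by apply: sumr_ge0 => j _; rewrite mulr_ge0//; case: (HB j).
move=> h M ch hM; apply: le_trans (nrm_sum _ _ _) _.
rewrite mulr_suml; apply: ler_sum => j _; rewrite path_integralE.
rewrite -mulrA; apply: cint_bound; first exact: cont01C_integrand.
move=> t t01; rewrite nrmM mulrC; apply: ler_pM; rewrite ?nrm_ge0//.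
  exact: (HB j).2.
by apply: hM; exists j, t.
Qed.

(** The integral over a closed contour of a function with a primitive is 0. *)
Lemma contour_integral_primitive (F f : Cplx R -> Cplx R) :
  (forall j t, 0 <= t <= 1 -> cderiv (fun s => F (Gamma j s)) t
     (f (Gamma j t) * path_deriv (Gamma j) t)) ->
  cont_on f -> contour_integral f Gamma = 0.
Proof.
move=> dF cf; rewrite /contour_integral.
rewrite (eq_bigr (fun j => F (Gamma (ordS j) 0) - F (Gamma j 0))).
  rewrite sumrB [X in _ - X](reindex (@ordS m)) ?subrr//.
  by apply: onW_bij; exact: ordS_bij.
move=> j _; rewrite path_integralE -CG.2.
apply: (cint_FTC (q := fun s => F (Gamma j s))); last exact: cont01C_integrand.
by move=> t t01; exact: dF.
Qed.

Lemma cont_on_subX z k : cont_on (fun w => (w - z) ^+ k).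
Proof.
move=> w _; apply: (cont_atX (f := fun w => w - z)).
by apply: cont_atB; [exact: cont_at_id | exact: cont_at_cst].
Qed.

Lemma cont_on_subV z : ~ on_trace z -> cont_on (fun w => (w - z)^-1).
Proof.
move=> nz w Tw; apply: (cont_atV (f := fun w => w - z)).
  by rewrite subr_eq0; apply/eqP => wz; apply: nz; rewrite -wz.
by apply: cont_atB; [exact: cont_at_id | exact: cont_at_cst].
Qed.

Lemma cont_on_subVX z k : ~ on_trace z -> cont_on (fun w => (w - z)^-1 ^+ k).
Proof.
move=> nz w Tw; apply: (cont_atX (f := fun w => (w - z)^-1)).
exact: cont_on_subV.
Qed.

Lemma contour_integral_subX z k : contour_integral (fun w => (w - z) ^+ k) Gamma = 0.
Proof.
apply: (contour_integral_primitive (F := fun w => k.+1%:R^-1 * (w - z) ^+ k.+1)); last first.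
  exact: cont_on_subX.
move=> j t t01.
have := cderivM (cderiv_cst (k.+1%:R^-1) t)
  (cderivX k (cderiv_sub z (cderiv_path t (CG.1 j)))).
by congr cderiv; rewrite mul0r add0r -mulrA mulKf// pnatr_eq0.
Qed.

Lemma contour_integral_subVX z k : ~ on_trace z ->
  contour_integral (fun w => (w - z)^-1 ^+ k.+2) Gamma = 0.
Proof.
move=> nz.
apply: (contour_integral_primitive
  (F := fun w => - k.+1%:R^-1 * (w - z)^-1 ^+ k.+1)); last first.
  exact: cont_on_subVX.
move=> j t t01.
have wz : Gamma j t - z != 0.
  by rewrite subr_eq0; apply/eqP => wz; apply: nz; rewrite -wz; exists j, t.
have := cderivM (cderiv_cst (- k.+1%:R^-1) t)
  (cderivX k (cderivV (cderiv_sub z (cderiv_path t (CG.1 j))) wz)).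
have k0 : k.+1%:R != 0 :> Cplx R by rewrite pnatr_eq0.
congr cderiv; rewrite mul0r add0r -exprVn /=.
set u := (_ - z)^-1; set d := path_deriv _ _; rewrite [u ^+ k.+2]exprS [u ^+ k.+1]exprS.
by field.
Qed.

End Contour.

(** * Cauchy integrals and winding numbers off the contour *)

Section Dixon.
Variables (R : realType) (m : nat) (Gamma : 'I_m -> R -> Cplx R).
Implicit Types (f g h : Cplx R -> Cplx R) (z w : Cplx R).
Hypothesis CG : closed_contour Gamma.

Local Notation oint h := (contour_integral h Gamma).

Lemma trace_dist z : ~ on_trace Gamma z ->
  exists2 d : R, 0 < d & forall w, on_trace Gamma w -> d <= nrm (w - z).
Proof.
move=> nz; have [D D0 HD] := trace_bounded CG (cont_on_subV nz).
have D1 : 0 < D + 1 by rewrite ltr_wpDl.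
exists (D + 1)^-1 => [|w Tw]; first by rewrite invr_gt0.
have wz : 0 < nrm (w - z).
  by rewrite nrm_gt0 subr_eq0; apply/eqP => wz; apply: nz; rewrite -wz.
rewrite -(invrK (nrm (w - z))) lef_pV2 ?posrE ?invr_gt0//.
by rewrite -nrmV; apply: le_trans (HD w Tw) _; rewrite lerDl.
Qed.

(** A Cauchy integral is analytic off the contour. *)
Lemma cauchy_integral_taylor h z0 : cont_on Gamma h -> ~ on_trace Gamma z0 ->
  exists C rho,
  taylor (fun z => oint (fun w => h w * (w - z)^-1)) z0
    (fun k => oint (fun w => h w * (w - z0)^-1 ^+ k.+1)) C rho /\
  forall z, nrm (z - z0) <= rho -> ~ on_trace Gamma z.
Proof.
move=> ch nz0; have [d d0 Hd] := trace_dist nz0.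
have [H H0 HH] := trace_bounded CG ch.
have [L L0 HL] := contour_integral_bound CG.
have d20 : 0 < d / 2 by rewrite divr_gt0.
have off z : nrm (z - z0) <= d / 2 -> ~ on_trace Gamma z.
  by move=> zd /Hd; apply/negP; rewrite -ltNge; apply: le_lt_trans zd _; lra.
exists (L * (2 * H / d)), (d / 2); split=> //; split=> // z K zd.
have nz := off z zd.
pose F k w := h w * (w - z0)^-1 ^+ k.+1 * (z - z0) ^+ k.
have cV k : cont_on Gamma (fun w => h w * (w - z0)^-1 ^+ k.+1).
  exact (cont_onM ch (cont_on_subVX nz0)).
have cF k : cont_on Gamma (F k).
  exact (cont_onM (cV k) (@cont_on_cst _ _ Gamma ((z - z0) ^+ k))).
have cz : cont_on Gamma (fun w => h w * (w - z)^-1).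
  exact (cont_onM ch (cont_on_subV nz)).
have cS : cont_on Gamma (fun w => \sum_(k < K) F k w).
  exact (cont_on_sum (fun k : 'I_K => cF k)).
have -> : tpoly (fun k => oint (fun w => h w * (w - z0)^-1 ^+ k.+1)) z0 K z =
   oint (fun w => \sum_(k < K) F k w).
  rewrite (contour_integral_sum CG _ (fun k : 'I_K => cF k)).
  apply: eq_bigr => k _; rewrite mulrC -(contour_integralZ CG _ (cV k)).
  by apply: eq_contour_integral => w _; rewrite mulrC.
rewrite -(contour_integralB CG cz cS) -ler_pdivlMr ?exprn_gt0//.
apply: (@le_trans _ _ (L * (2 * H * nrm (z - z0) ^+ K / d ^+ K.+1))).
  apply: HL; first exact (cont_onB cz cS).
  move=> w Tw; rewrite ler_pdivlMr ?exprn_gt0//.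
  have dw := Hd w Tw.
  have w0 : w - z0 != 0 by rewrite -nrm_gt0; exact: lt_le_trans dw.
  have := @kernel_bound R (fun k => h w * (w - z0)^-1 ^+ k) (fun=> 0) 0 (w - z0)
    (z - z0) H d K d0.
  rewrite expr0 mulr1 subr0.
  have -> : w - z0 - (z - z0) = w - z by ring.
  apply=> //.
  - by move=> k; rewrite subr0 exprS mulrCA mulVKf.
  - move=> k; rewrite nrmM nrmX nrmV -mulrA -exprMn.
    apply: le_trans (HH w Tw); rewrite ler_piMr ?nrm_ge0//.
    rewrite exprn_ile1//; first by apply: mulr_ge0; rewrite ?invr_ge0 ?nrm_ge0 ?ltW.
    by rewrite mulrC ler_pdivrMr ?mul1r// nrm_gt0.
  - move=> k; rewrite big1 ?subrr ?nrm0 ?mul0r; last by move=> i _; rewrite mul0r.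
    by rewrite mulr_ge0// exprn_ge0 ?nrm_ge0.
  - apply/eqP => E; move: dw; rewrite E; apply/negP; rewrite -ltNge.
    by apply: le_lt_trans zd _; lra.
have -> : L * (2 * H / d) * nrm (z - z0) ^+ K / (d / 2) ^+ K =
  L * (2 * H * nrm (z - z0) ^+ K / d ^+ K.+1) * 2 ^+ K.
  rewrite exprS exprMn exprVn; field.
  by rewrite !expf_neq0 ?gt_eqF.
rewrite ler_peMr ?exprn_ege1 ?ler1n//.
apply: mulr_ge0 => //; apply: divr_ge0; last by rewrite exprn_ge0// ltW.
by apply: mulr_ge0; [exact: mulr_ge0 | rewrite exprn_ge0 ?nrm_ge0].
Qed.

Lemma winding0E z : winding Gamma z = 0 -> oint (fun w => (w - z)^-1) = 0.
Proof.
move=> /eqP; rewrite /winding mulf_eq0 invr_eq0 => /orP[|/eqP//].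
by rewrite eq_complex => /andP[_ /=]; rewrite mulf_eq0 pnatr_eq0 /= gt_eqF ?pi_gt0.
Qed.

(** Off the contour, the vanishing of the winding number is an open condition. *)
Lemma winding_near z0 : ~ on_trace Gamma z0 -> oint (fun w => (w - z0)^-1) = 0 ->
  exists2 rho : R, 0 < rho & forall z, nrm (z - z0) <= rho ->
    oint (fun w => (w - z)^-1) = 0.
Proof.
move=> nz0 wz0.
have [C [rho [tW _]]] := cauchy_integral_taylor (@cont_on_cst _ _ Gamma 1) nz0.
have [r0 _] := tW.
have E z : oint (fun w => 1 * (w - z)^-1) = oint (fun w => (w - z)^-1).
  by apply: eq_contour_integral => w _; rewrite mul1r.
exists (rho / 2) => [|z zr]; first by rewrite divr_gt0.
(* the higher Taylor coefficients are integrals of functions with a primitive *)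
rewrite -E (taylor_cst tW) ?E// => -[//|k] _.
rewrite -(contour_integral_subVX CG k nz0); apply: eq_contour_integral => w _; by rewrite mul1r.
Qed.

(** Points far away are not surrounded. *)
Lemma winding_far : exists M : R, forall z, M <= nrm z ->
  ~ on_trace Gamma z /\ oint (fun w => (w - z)^-1) = 0.
Proof.
have cid : cont_on Gamma id by move=> w _; exact: cont_at_id.
have [B B0 HB] := trace_bounded CG cid.
have [L L0 HL] := contour_integral_bound CG.
exists (2 * B + 1) => z zM.
have zw w : on_trace Gamma w -> nrm z <= 2 * nrm (w - z) /\ nrm w <= nrm z / 2.
  by move=> Tw; have := HB w Tw; have := nrmBr z w; rewrite nrmC /=; split; lra.
have z0 : 0 < nrm z by lra.
have nz : ~ on_trace Gamma z.
  by move=> Tz; have [] := zw z Tz; lra.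
split=> //.
have zz : z != 0 by rewrite -nrm_gt0.
apply/eqP; rewrite -nrm_eq0; apply/eqP/le_anti; rewrite nrm_ge0 andbT.
apply/ler_addgt0Pr => e e0; rewrite add0r.
have e1 : 0 < e / (L * (2 / nrm z) + 1).
  by rewrite divr_gt0// ltr_wpDl// mulr_ge0// divr_ge0// ltW.
have [K HK] := half_pow_lt e1.
have cK : cont_on Gamma (fun w => (w / z) ^+ K * (w - z)^-1).
  have cK1 : cont_on Gamma (fun w => (w / z) ^+ K).
    move=> w _; apply: (cont_atX (f := fun w => w / z)).
    exact (cont_atM (@cont_at_id _ w) (@cont_at_cst _ (z^-1) w)).
  exact (cont_onM cK1 (cont_on_subV nz)).
(* subtracting the first terms of the expansion in 1/z, which integrate to 0 *)
have -> : oint (fun w => (w - z)^-1) = oint (fun w => (w / z) ^+ K * (w - z)^-1).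
  pose F k w := - z^-1 ^+ k.+1 * (w - 0) ^+ k.
  have cs k : cont_on Gamma (F k) by exact (cont_onZ (@cont_on_subX _ _ Gamma 0 k)).
  have cS : cont_on Gamma (fun w => \sum_(k < K) F k w).
    exact (cont_on_sum (fun k : 'I_K => cs k)).
  have S0 : oint (fun w => \sum_(k < K) F k w) = 0.
    rewrite (contour_integral_sum CG _ (fun k : 'I_K => cs k)) big1// => k _.
    rewrite (contour_integralZ CG _ (@cont_on_subX _ _ Gamma 0 k)).
    by rewrite (contour_integral_subX CG) mulr0.
  rewrite -[RHS]addr0 -S0 -(contour_integralD CG cK cS).
  apply: eq_contour_integral => w Tw.
  have wz : w - z != 0 by rewrite subr_eq0; apply/eqP => E; apply: nz; rewrite -E.
  apply: (mulfI wz); rewrite mulfV// mulrDr mulrCA mulfV// mulr1.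
  have -> : \sum_(k < K) F k w = - \sum_(k < K) z^-1 ^+ k.+1 * w ^+ k.
    by rewrite -sumrN; apply: eq_bigr => k _; rewrite /F subr0 mulNr.
  rewrite mulrN -mulNr opprB.
  rewrite (@kernel_telescope R (fun k => z^-1 ^+ k) (fun=> 0)).
    rewrite big1 => [|i _]; last by rewrite mul0r.
    by rewrite expr0 exprMn; ring.
  by move=> k; rewrite subr0 exprS mulVKf.
apply: (@le_trans _ _ (L * (2^-1 ^+ K * (2 / nrm z)))).
  apply: HL cK _ => w /[dup] Tw /zw[zw1 zw2].
  rewrite nrmM nrmX nrmM !nrmV; apply: ler_pM.
  - by rewrite exprn_ge0// divr_ge0 ?nrm_ge0.
  - by rewrite invr_ge0 nrm_ge0.
  - rewrite lerXn2r ?nnegrE ?divr_ge0 ?nrm_ge0//.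
    by rewrite ler_pdivrMr// mulrC.
  - have wz : 0 < nrm (w - z) by lra.
    by rewrite ler_pdivlMr// mulrC ler_pdivrMr.
have p0 : 0 <= (2^-1 : R) ^+ K by rewrite exprn_ge0 ?invr_ge0.
move: HK; rewrite ltr_pdivlMr; last by rewrite ltr_wpDl// mulr_ge0// divr_ge0// ltW.
by set q := 2 / nrm z; move=> HK; nra.
Qed.

End Dixon.

(** * Cauchy's formula in homological form *)

Section DixonMain.
Variables (R : realType) (m : nat) (Gamma : 'I_m -> R -> Cplx R).
Variables (Omega : set (Cplx R)) (f : Cplx R -> Cplx R).
Implicit Types (g h : Cplx R -> Cplx R) (z w : Cplx R).
Hypothesis CG : closed_contour Gamma.
Hypothesis oO : open Omega.
(* the contour lies in Omega and surrounds no point of its complement *)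
Hypothesis TO : forall w, on_trace Gamma w -> Omega w.
Hypothesis wO : forall z, ~ Omega z -> contour_integral (fun w => (w - z)^-1) Gamma = 0.
Hypothesis fO : forall z, Omega z -> exists a C rho, taylor f z a C rho.

Local Notation oint h := (contour_integral h Gamma).

Lemma cont_on_f : cont_on Gamma f.
Proof.
by move=> w /TO/fO[a [C [rho /taylor_continuous]]].
Qed.

(** Difference quotient, extended to the diagonal by the derivative. *)
Definition dquot z w := if w == z then derive1 f z else (f w - f z) / (w - z).

Lemma dquot_trem z a C rho w : taylor f z a C rho -> dquot z w = trem f z a 1 w.
Proof.
move=> tf; rewrite /dquot /trem (taylor_derive1 tf) tpolyS tpoly0.
by rewrite (taylor_at tf) !expr0 add0r mulr1 expr1.
Qed.

(** Dixon's function. *)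
Definition dixon z : Cplx R :=
  if `[< Omega z >] then oint (dquot z) else oint (fun w => f w * (w - z)^-1).

Lemma cont_on_trem z a C rho k : taylor f z a C rho -> cont_on Gamma (trem f z a k).
Proof. by move=> tf w /cont_on_f; exact: trem_continuousP tf. Qed.

Lemma dixon_out z : ~ on_trace Gamma z -> oint (fun w => (w - z)^-1) = 0 ->
  dixon z = oint (fun w => f w * (w - z)^-1).
Proof.
move=> nz wz; rewrite /dixon; case: asboolP => // Oz.
have c1 : cont_on Gamma (fun w => f w * (w - z)^-1).
  exact (cont_onM cont_on_f (cont_on_subV nz)).
have c2 : cont_on Gamma (fun w => f z * (w - z)^-1).
  exact (cont_onZ (cont_on_subV nz)).
rewrite -[RHS]subr0 -(mulr0 (f z)) -wz.
rewrite -(contour_integralZ CG _ (cont_on_subV nz)) -(contour_integralB CG c1 c2).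
apply: eq_contour_integral => w Tw; rewrite /dquot.
case: eqP => [E|_]; first by case: nz; rewrite -E.
by rewrite mulrBl.
Qed.

(** In [Omega], the difference quotient is expanded and integrated term by term. *)
Lemma dixon_in z0 a C rho : Omega z0 -> taylor f z0 a C rho ->
  exists C' rho', taylor dixon z0 (fun k => oint (trem f z0 a k.+1)) C' rho'.
Proof.
move=> Oz0 tf0.
have [e e0 He] : exists2 e : R, 0 < e & forall w, nrm (w - z0) < e -> Omega w.
  by apply/near_nrm; exact: open_nbhs_nbhs.
pose r := Num.min rho e.
have r0 : 0 < r by rewrite lt_min e0 andbT; case: tf0.
have re : r <= e by rewrite ge_min lexx orbT.
have tf : taylor f z0 a C r.
  by apply: taylor_shrink tf0 r0 _; rewrite ge_min lexx.
have C0 := taylor_ge0 tf.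
have [H H0 HH] := trace_bounded CG cont_on_f.
have [L L0 HL] := contour_integral_bound CG.
have r20 : 0 < r / 2 by rewrite divr_gt0.
exists (L * (2 * (H + 5 * C) / (r / 2))), (r / 4); split=> [|z K zr].
  by rewrite divr_gt0.
have Oz : Omega z by apply: He; apply: le_lt_trans zr _; lra.
have [b [C' [rho' tz]]] := fO Oz.
have cF k : cont_on Gamma (fun w => trem f z0 a k.+1 w * (z - z0) ^+ k).
  exact (cont_onM (cont_on_trem (k := k.+1) tf) (@cont_on_cst _ _ Gamma ((z - z0) ^+ k))).
have cS := cont_on_sum (s := index_enum 'I_K) (fun k : 'I_K => cF k).
have -> : dixon z = oint (trem f z b 1).
  rewrite /dixon (asboolT Oz); apply: eq_contour_integral => w _; exact (dquot_trem w tz).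
have -> : tpoly (fun k => oint (trem f z0 a k.+1)) z0 K z =
   oint (fun w => \sum_(k < K) trem f z0 a k.+1 w * (z - z0) ^+ k).
  rewrite (contour_integral_sum CG _ (fun k : 'I_K => cF k)); apply: eq_bigr => k _.
  rewrite mulrC -(contour_integralZ CG _ (cont_on_trem (k := k.+1) tf)).
  by apply: eq_contour_integral => w _; rewrite mulrC.
rewrite -(contour_integralB CG (cont_on_trem (k := 1) tz) cS).
set I := nrm _.
have I0 : 0 <= I by exact: nrm_ge0.
have HI : I <= L * (2 * (H + 5 * C) * nrm (z - z0) ^+ K / (r / 2) ^+ K.+1).
  apply: HL; first exact (cont_onB (cont_on_trem (k := 1) tz) cS).
  move=> w Tw; rewrite ler_pdivlMr ?exprn_gt0//.
  exact: diff_quotient_taylor tf tz zr (HH w Tw).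
apply: (@le_trans _ _ (I * (r / 2) ^+ K)).
  rewrite ler_wpM2l// lerXn2r// ?nnegrE ?divr_ge0 ?(ltW r0)//; lra.
have -> : L * (2 * (H + 5 * C) / (r / 2)) * nrm (z - z0) ^+ K =
  L * (2 * (H + 5 * C) * nrm (z - z0) ^+ K / (r / 2) ^+ K.+1) * (r / 2) ^+ K.
  by rewrite exprS; field; rewrite expf_neq0 ?gt_eqF.
by rewrite ler_wpM2r// exprn_ge0// ltW.
Qed.

Lemma taylor_ext g h z0 a C rho e : taylor g z0 a C rho -> 0 < e ->
  (forall z, nrm (z - z0) <= e -> g z = h z) -> exists rho', taylor h z0 a C rho'.
Proof.
move=> tg e0 gh; have [r0 _] := tg; exists (Num.min rho e).
have m0 : 0 < Num.min rho e by rewrite lt_min r0.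
have [_ H] : taylor g z0 a C (Num.min rho e).
  by apply: taylor_shrink tg m0 _; rewrite ge_min lexx.
split=> // w K wr; rewrite -gh; first exact: H.
by apply: le_trans wr _; rewrite ge_min lexx orbT.
Qed.

Lemma dixon_taylor z0 : exists a C rho, taylor dixon z0 a C rho.
Proof.
have [Oz0|nO] := pselect (Omega z0).
  have [a [C [rho tf]]] := fO Oz0.
  have [C' [rho' t]] := dixon_in Oz0 tf.
  by exists (fun k => oint (trem f z0 a k.+1)), C', rho'.
have nz0 : ~ on_trace Gamma z0 by move=> /TO.
have [C [rho [tW off]]] := cauchy_integral_taylor CG cont_on_f nz0.
have [rho1 r10 H1] := winding_near CG nz0 (wO nO).
have [r0 _] := tW.
have m0 : 0 < Num.min rho rho1 by rewrite lt_min r0.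
have [|rho' t] := taylor_ext (h := dixon) tW m0.
  move=> z zr; rewrite dixon_out//.
    by apply: off; apply: le_trans zr _; rewrite ge_min lexx.
  by apply: H1; apply: le_trans zr _; rewrite ge_min lexx orbT.
by eexists; exists C, rho'; exact: t.
Qed.

Lemma dixon0 z : dixon z = 0.
Proof.
apply: entire_vanishing => {z}; first exact: dixon_taylor.
move=> e e0.
have [M HM] := winding_far CG.
have [H H0 HH] := trace_bounded CG cont_on_f.
have [L L0 HL] := contour_integral_bound CG.
have cid : cont_on Gamma id by move=> w _; exact: cont_at_id.
have [B B0 HB] := trace_bounded CG cid.
pose D := L * H / e + 1.
have D0 : 0 < D.
  by rewrite ltr_wpDl// divr_ge0 ?mulr_ge0// ltW.
exists (Num.max M (B + D)) => z; rewrite ge_max => /andP[/HM[nz wz] zB].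
rewrite dixon_out//; apply: (@le_lt_trans _ _ (L * (H / D))).
  apply: HL; first exact (cont_onM cont_on_f (cont_on_subV nz)).
  move=> w Tw; rewrite nrmM nrmV; have := HB w Tw => /= wB.
  have zw : D <= nrm (w - z) by have := nrmBr z w; rewrite nrmC; lra.
  apply: ler_pM; rewrite ?nrm_ge0 ?invr_ge0 ?nrm_ge0//; first exact: HH.
  by rewrite lef_pV2// posrE//; exact: lt_le_trans zw.
rewrite mulrA ltr_pdivrMr// /D mulrDr mulr1 mulrCA mulfV ?gt_eqF// mulr1.
by rewrite ltrDl.
Qed.

(** The Taylor coefficients of [dixon], computed by [dixon_in], vanish. *)
Lemma contour_integral_trem z0 a C rho k : Omega z0 -> taylor f z0 a C rho ->
  oint (trem f z0 a k.+1) = 0.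
Proof.
move=> Oz0 tf; have [C' [rho' t]] := dixon_in Oz0 tf.
have E : dixon = fun=> 0 by apply/funext => z; exact: dixon0.
have := taylor_derive1n openT (fun z _ => dixon_taylor z) k Logic.I t.
rewrite E.
have -> : derive1n k (fun=> 0 : Cplx R) = fun=> 0.
  elim: k => // k IH; rewrite derive1nS IH; apply/funext => z.
  exact: derive1_cst.
move=> /esym/eqP; rewrite mulf_eq0 pnatr_eq0 -leqn0 leqNgt fact_gt0 /=.
by move/eqP.
Qed.

(** Cauchy's integral formulas for the derivatives, in homological form. *)
Lemma cauchy_formula z0 a C rho k : Omega z0 -> ~ on_trace Gamma z0 ->
  taylor f z0 a C rho ->
  oint (fun w => f w * (w - z0)^-1 ^+ k.+1) =
  a k * oint (fun w => (w - z0)^-1).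
Proof.
move=> Oz0 nz0 tf; have f0 := taylor_at tf.
have cV := cont_on_subV nz0.
have ct := cont_on_trem (k := k) tf.
pose F j w := a j * (w - z0)^-1 ^+ (k - j).+1.
have cF j : cont_on Gamma (F j).
  exact (cont_onZ (cont_on_subVX nz0)).
have cS := cont_on_sum (s := index_enum 'I_k) (fun j : 'I_k => cF j).
have wz w : on_trace Gamma w -> w - z0 != 0.
  by move=> Tw; rewrite subr_eq0; apply/eqP => E; apply: nz0; rewrite -E.
have -> : oint (fun w => f w * (w - z0)^-1 ^+ k.+1) =
    oint (fun w => trem f z0 a k w * (w - z0)^-1 + \sum_(j < k) F j w).
  apply: eq_contour_integral => w /wz w0; rewrite (trem_expand k w f0) mulrDl addrC.
  congr (_ + _).
    rewrite mulrAC exprSr mulrA -exprMn mulfV// expr1n; ring.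
  rewrite /tpoly mulr_suml; apply: eq_bigr => j _; rewrite /F -mulrA; congr (_ * _).
  have -> : k.+1 = (j + (k - j).+1)%N by rewrite addnS subnKC// ltnW.
  rewrite exprD mulrA -exprMn mulfV//.
  by rewrite expr1n mul1r.
rewrite (contour_integralD CG (cont_onM ct cV) cS).
rewrite (contour_integral_sum CG _ (fun j : 'I_k => cF j)) big1 ?addr0; last first.
  move=> j _; rewrite (contour_integralZ CG _ (cont_on_subVX nz0)).
  by rewrite -(subnSK (ltn_ord j)) (contour_integral_subVX CG _ nz0) mulr0.
(* trem k.+1 is (trem k - a k) / (w - z0), and its integral is 0 *)
rewrite -(contour_integralZ CG _ cV) -[LHS]subr0 -(contour_integral_trem k Oz0 tf).
rewrite -(contour_integralB CG (cont_onM ct cV) (cont_on_trem (k := k.+1) tf)).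
apply: eq_contour_integral => w /wz w0.
have -> : trem f z0 a k.+1 w = (trem f z0 a k w - a k) * (w - z0)^-1.
  by rewrite -tremS// mulrAC mulfV// mul1r.
ring.
Qed.

End DixonMain.

(** * Nilpotent matrices and compositional inversion *)

Section Jacobson.
Variables (F : fieldType) (n : nat).
Implicit Types (A B X : 'M[F]_n.+1) (p : {poly F}).

Lemma comm_horner_mx A B p : comm_mx A B -> comm_mx (horner_mx A p) B.
Proof.
move=> AB; elim/poly_ind: p => [|p c IH]; first by rewrite raddf0; exact: comm0mx.
rewrite rmorphD rmorphM /= horner_mx_X horner_mx_C.
apply: comm_mx_sym; apply: comm_mxD; last exact: comm_mx_scalar.
by apply: comm_mxM; exact: comm_mx_sym.
Qed.

(** If [XA - AX] commutes with [X], then bracketing with [A] acts on the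
    polynomials in [X] as a derivation. *)
Lemma bracket_horner A B X p : B = X *m A - A *m X -> comm_mx X B ->
  horner_mx X p *m A - A *m horner_mx X p = horner_mx X p^`() *m B.
Proof.
move=> BE XB; elim/poly_ind: p => [|p c IH].
  by rewrite deriv0 !rmorph0 !mul0mx mulmx0 subr0.
have -> : (p * 'X + c%:P)^`() = p^`() * 'X + p.
  by rewrite derivD derivM derivX derivC addr0 mulr1.
rewrite !(rmorphD, rmorphM) /= horner_mx_X horner_mx_C -!mulmxE.
set Q := horner_mx X p in IH *; set Q' := horner_mx X _ in IH *.
rewrite [LHS](_ : _ = Q *m X *m A - A *m Q *m X); last first.
  by rewrite mulmxDl mulmxDr scalar_mxC opprD addrACA subrr addr0 mulmxA.
rewrite mulmxDl -[Q' *m X *m B]mulmxA XB mulmxA -IH BE mulmxBl mulmxBr !mulmxA.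
by rewrite [RHS]addrC addrA subrK.
Qed.

(** Jacobson's lemma: in characteristic 0, a bracket [XA - AX] commuting with [X]
    is nilpotent. *)
Lemma jacobson_nilpotent A B X : [pchar F] =i pred0 ->
  B = X *m A - A *m X -> comm_mx X B -> exists k, B ^+ k = 0.
Proof.
move=> ch0 BE XB; pose p := char_poly X.
(* bracket with A, then multiply on the left by B^k *)
have step j k : horner_mx X p^`(j) * B ^+ k = 0 ->
    horner_mx X p^`(j.+1) * B ^+ (k + k.+1) = 0.
  rewrite derivnS; set Q := horner_mx X p^`(j) => QB.
  have QBc : Q * B ^+ k = B ^+ k * Q.
    by apply: commrX; exact: comm_horner_mx.
  have Q'Bc : horner_mx X p^`(j)^`() * B ^+ k = B ^+ k * horner_mx X p^`(j)^`().
    by apply: commrX; exact: comm_horner_mx.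
  have AQ : horner_mx X p^`(j)^`() * B = Q * A - A * Q.
    by rewrite -!mulmxE (bracket_horner _ BE XB).
  move: Q'Bc AQ; set Q' := horner_mx X _ => Q'Bc AQ.
  rewrite exprD exprS [LHS]mulrA Q'Bc -[LHS]mulrA [Q' * _]mulrA AQ.
  by rewrite mulrBl -[A * Q * _]mulrA QB mulr0 subr0 !mulrA -QBc QB !mul0r.
have main j : exists k, horner_mx X p^`(j) * B ^+ k = 0.
  elim: j => [|j [k IH]]; last by exists (k + k.+1)%N; exact: step.
  by exists 0%N; rewrite derivn0 Cayley_Hamilton mul0r.
have [k Hk] := main n.+1.
have pn : p^`(n.+1) = (n.+1`!)%:R%:P.
  apply/polyP => i; rewrite coef_derivn coefC.
  case: i => [|i] /=.
    rewrite addn0 ffactnn; have := char_poly_monic X; rewrite monicE lead_coefE.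
    by rewrite size_char_poly /= => /eqP ->.
  by rewrite nth_default ?mul0rn// size_char_poly addnS ltnS leq_addr.
exists k; move: Hk; rewrite pn horner_mx_C -mulmxE mul_scalar_mx => /eqP.
rewrite scaler_eq0 => /orP[|/eqP//].
by move/pcharf0P: ch0 => ->; rewrite -leqn0 leqNgt fact_gt0.
Qed.

(** The minimal polynomial of [B] is a power of the indeterminate, of degree at
    most [n+1]. *)
Lemma nilpotent_mx_order B k : B ^+ k = 0 -> B ^+ n.+1 = 0.
Proof.
move=> Bk.
have : mxminpoly B %| ('X - 0%:P) ^+ k.
  by apply: mxminpoly_min; rewrite subr0 rmorphXn /= horner_mx_X.
move=> /dvdp_exp_XsubCP[d _ Bd].
have dn : (d <= n.+1)%N.
  have /dvdp_leq : ('X - 0%:P) ^+ d %| char_poly B.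
    by rewrite -(eqp_dvdl _ Bd) mxminpoly_dvd_char.
  by rewrite monic_neq0 ?char_poly_monic// size_exp_XsubC size_char_poly ltnS; apply.
have : mxminpoly B %| ('X - 0%:P) ^+ d by rewrite (eqp_dvdl _ Bd).
move=> /dvdpP[q E].
have : horner_mx B (('X - 0%:P) ^+ d) = 0.
  by rewrite E rmorphM /= mx_root_minpoly mulr0.
rewrite subr0 rmorphXn /= horner_mx_X => Bd0.
have H j : (d <= j)%N -> B ^+ j = 0 by move=> dj; rewrite -(subnK dj) exprD Bd0 mulr0.
exact: H.
Qed.

Lemma spectrum_nilpotent B k a : B ^+ k = 0 -> eigenvalue B a = (a == 0).
Proof.
move=> Bk; apply/idP/eqP => [/eigenvalueP[v vB v0]|->].
  have : v *m B ^+ k = a ^+ k *: v.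
    elim: (k) => [|j IH]; first by rewrite expr0 mulmx1 scale1r.
    by rewrite exprS -mulmxE mulmxA vB -scalemxAl IH scalerA exprS.
  rewrite Bk mulmx0 => /esym/eqP; rewrite scaler_eq0 (negbTE v0) orbF.
  by rewrite expf_eq0 => /andP[_ /eqP].
rewrite eigenvalue_root_char /root -horner_evalE /char_poly -det_map_mx.
have -> : map_mx (horner_eval (0 : F)) (char_poly_mx B) = - B.
  apply/matrixP => i j; rewrite !mxE horner_evalE !hornerE.
  by case: eqP => _; rewrite ?hornerE ?sub0r.
have : \det (B ^+ k) = 0 by rewrite Bk det0.
have -> : \det (B ^+ k) = \det B ^+ k.
  elim: (k) => [|j IH]; first by rewrite det1.
  by rewrite !exprS det_mulmx IH.
move=> /eqP; rewrite expf_eq0 => /andP[_ /eqP B0].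
by rewrite -scaleN1r detZ B0 mulr0.
Qed.

Lemma resolvent_nilpotent B z : B ^+ n.+1 = 0 -> z != 0 ->
  invmx (z%:M - B) = \sum_(k < n.+1) z^-1 ^+ k.+1 *: B ^+ k.
Proof.
move=> Bn z0; set S := \sum_(k < _) _.
have E : (z%:M - B) *m S = 1%:M.
  have : forall K, (z%:M - B) *m (\sum_(k < K) z^-1 ^+ k.+1 *: B ^+ k) =
      1%:M - z^-1 ^+ K *: B ^+ K.
    elim=> [|K IH]; first by rewrite big_ord0 mulmx0 !expr0 scale1r subrr.
    rewrite big_ord_recr /= mulmxDr IH -scalemxAr mulmxBl mul_scalar_mx.
    have e : z^-1 ^+ K.+1 * z = z^-1 ^+ K by rewrite exprSr -mulrA mulVf// mulr1.
    by rewrite scalerBr scalerA e addrA subrK [B ^+ K.+1]exprS.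
  by move/(_ n.+1); rewrite Bn scaler0 subr0.
by have [u _] := mulmx1_unit E; rewrite -[RHS](mulKmx u) E mulmx1.
Qed.

End Jacobson.

Section Inversion.

(** The polynomial [a_0 X + ... + a_(m-1) X^m]; the index is shifted by one, as
    there is no constant term. *)
Definition spoly (S : comNzRingType) m (a : 'I_m -> S) : {poly S} :=
  \sum_(i < m) a i *: 'X^(i.+1).

(** Its powers modulo [X^(m+1)]: column [k] lists the coefficients of
    [X, ..., X^m] in the [(k+1)]-st power of [spoly a]. *)
Definition power_mx (S : comNzRingType) m (a : 'I_m -> S) : 'M[S]_m :=
  \matrix_(j, k) (spoly a ^+ k.+1)`_j.+1.

Lemma map_power_mx (S T : comNzRingType) (phi : {rmorphism S -> T}) m (a : 'I_m -> S) :
  map_mx phi (power_mx a) = power_mx (phi \o a).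
Proof.
apply/matrixP => j k; rewrite !mxE -coef_map rmorphXn /=.
have -> : map_poly phi (spoly a) = spoly (phi \o a); last by [].
rewrite /spoly rmorph_sum; apply: eq_bigr => i _ /=.
by rewrite map_polyZ map_polyXn.
Qed.

Variables (F : fieldType) (m : nat) (a : 'I_m.+1 -> F).

Lemma spolyE : exists2 q : {poly F}, spoly a = 'X * q & q`_0 = a ord0.
Proof.
exists (\sum_(i < m.+1) a i *: 'X^i).
  by rewrite mulr_sumr; apply: eq_bigr => i _; rewrite -scalerAr exprS.
rewrite coef_sum big_ord_recl /= expr0 coefZ coef1 mulr1 big1 ?addr0// => i _.
by rewrite coefZ coefXn /= mulr0.
Qed.

Lemma det_power_mx : a ord0 != 0 -> \det (power_mx a) != 0.
Proof.
move=> a0; have [q E q0] := spolyE.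
have pE k : spoly a ^+ k = q ^+ k * 'X^k by rewrite E exprMn mulrC.
rewrite det_trig.
  apply/prodf_neq0 => i _; rewrite mxE pE coefMXn ltnn subnn.
  by rewrite -horner_coef0 horner_exp horner_coef0 q0 expf_neq0.
by apply/is_trig_mxP => j k jk; rewrite mxE pE coefMXn ltnS jk.
Qed.

(** Coefficients of the compositional inverse of [spoly a], by Cramer's rule:
    [power_mx a] sends them to the coefficients of the monomial [X]. *)
Definition inv_coef (k : 'I_m.+1) : F :=
  (\adj (power_mx a)) k ord0 / \det (power_mx a).

Lemma inv_coefE : a ord0 != 0 ->
  forall j : 'I_m.+1, \sum_(k < m.+1) inv_coef k * (spoly a ^+ k.+1)`_j.+1 =
    (j == ord0)%:R.
Proof.
move=> a0 j; have d0 := det_power_mx a0.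
have /matrixP/(_ j ord0) := mul_mx_adj (power_mx a); rewrite !mxE => E.
rewrite -(mulfK d0 (_ == _)%:R) mulr_natl -E mulr_suml; apply: eq_bigr => k _.
by rewrite /inv_coef !mxE mulrAC [X in _ = X / _]mulrC.
Qed.

Lemma inv_coef0 : a ord0 != 0 -> inv_coef ord0 != 0.
Proof.
move=> a0; have := inv_coefE a0 ord0; rewrite big_ord_recl /= big1 ?addr0.
  by move=> E; apply/eqP => b0; move: E; rewrite b0 mul0r => /esym/eqP; rewrite oner_eq0.
move=> i _; have [q E _] := spolyE.
by rewrite E exprMn mulrC coefXnM mul0r.
Qed.

Lemma horner_mx_low n (B : 'M[F]_n.+1) (p : {poly F}) K : B ^+ K = 0 ->
  (forall j, (j < K)%N -> p`_j = 0) -> horner_mx B p = 0.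
Proof.
move=> BK pK; rewrite -[p]coefK poly_def rmorph_sum big1//= => i _.
rewrite linearZ /= rmorphXn /= horner_mx_X; have [iK|Ki] := ltnP i K.
  by rewrite pK// scale0r.
have H l : (K <= l)%N -> B ^+ l = 0 by move=> Kl; rewrite -(subnK Kl) exprD BK mulr0.
by rewrite H// scaler0.
Qed.

(** Compositional inversion, evaluated at a nilpotent matrix. *)
Lemma power_inversion n (B : 'M[F]_n.+1) : a ord0 != 0 -> B ^+ m.+2 = 0 ->
  let N := \sum_(i < m.+1) a i *: B ^+ i.+1 in
  B = \sum_(k < m.+1) inv_coef k *: N ^+ k.+1.
Proof.
move=> a0 Bm N.
have NE : N = horner_mx B (spoly a).
  rewrite /spoly rmorph_sum; apply: eq_bigr => i _ /=.
  by rewrite linearZ /= rmorphXn /= horner_mx_X.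
apply/eqP; rewrite eq_sym -subr_eq0; apply/eqP.
rewrite -[RHS](@horner_mx_low _ B (\sum_(k < m.+1) inv_coef k *: spoly a ^+ k.+1 - 'X) _ Bm).
  rewrite rmorphB rmorph_sum /= horner_mx_X; congr (_ - _); apply: eq_bigr => k _.
  by rewrite linearZ /= rmorphXn /= NE.
move=> [|j] jm; rewrite coefB coefX coef_sum.
  have [q E _] := spolyE.
  by rewrite big1 ?subr0// => k _; rewrite coefZ E exprMn coefXnM mulr0.
have jm' : (j < m.+1)%N by [].
have /= := inv_coefE a0 (Ordinal jm'); rewrite -val_eqE /= => E.
by rewrite eqSS -E; under eq_bigr do rewrite coefZ; rewrite subrr.
Qed.

End Inversion.

(** * Functional calculus at a nilpotent matrix *)

Section Polynomials.
Variable R : realType.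
Implicit Types (p q : {poly Cplx R}) (z c : Cplx R).

Lemma horner_taylor q z0 :
  exists C, taylor (fun w => q.[w - z0]) z0 (fun k => q`_k) C 1.
Proof.
pose M := \sum_(k < size q) nrm q`_k.
have M0 : 0 <= M by apply: sumr_ge0 => k _; exact: nrm_ge0.
have Mk k : nrm q`_k <= M.
  have [kq|qk] := ltnP k (size q); last by rewrite nth_default// nrm0.
  rewrite /M (bigD1 (Ordinal kq))//= lerDl sumr_ge0// => i _; exact: nrm_ge0.
exists ((size q)%:R * M); split=> // w K wr.
rewrite expr1n mulr1 (@horner_coef_wide _ (K + size q)%N) ?leq_addl//.
rewrite big_split_ord /= /tpoly addrAC subrr add0r.
apply: le_trans (nrm_sum _ _ _) _.
apply: (@le_trans _ _ (\sum_(i < size q) M * nrm (w - z0) ^+ K)).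
  apply: ler_sum => i _; rewrite nrmM nrmX exprD mulrCA mulrA.
  rewrite [_ * nrm q`__]mulrC -mulrA; apply: ler_pM; rewrite ?nrm_ge0 ?Mk//.
    by rewrite mulr_ge0 ?exprn_ge0 ?nrm_ge0.
  by rewrite ler_piMr ?exprn_ge0 ?nrm_ge0// exprn_ile1 ?nrm_ge0.
by rewrite sumr_const card_ord -[leLHS]mulr_natl mulrA.
Qed.

Lemma horner_taylor_everywhere q c z0 :
  exists a C rho, taylor (fun w => q.[w - c]) z0 a C rho.
Proof.
have [C H] := horner_taylor (q \Po ('X + (z0 - c)%:P)) z0.
exists (fun k => (q \Po ('X + (z0 - c)%:P))`_k), C, 1.
move: H; congr taylor; apply/funext => w.
rewrite horner_comp hornerD hornerX hornerC; congr (q.[_]); ring.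
Qed.

Lemma cont_at_horner q z : cont_at (fun w => q.[w]) z.
Proof.
have [a [C [rho /taylor_continuous]]] := horner_taylor_everywhere q 0 z.
by congr cont_at; apply/funext => w; rewrite subr0.
Qed.

End Polynomials.

Section FunctionalCalculus.
Variables (R : realType) (n : nat) (Omega : set (Cplx R)) (f : Cplx R -> Cplx R).
Implicit Types M Y : 'M[Cplx R]_n.
Hypothesis fO : forall z, Omega z -> exists a C rho, taylor f z a C rho.

(** The entries of the resolvent, written as rational functions; this form is
    valid off the spectrum. *)
Definition resolvent M i j (z : Cplx R) : Cplx R :=
  ((char_poly M).[z])^-1 * (\adj (char_poly_mx M) i j).[z].

Lemma horner_char_poly_mx M z : map_mx (horner_eval z) (char_poly_mx M) = z%:M - M.
Proof.
apply/matrixP => i j; rewrite !mxE horner_evalE !hornerE.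
by case: (i == j); rewrite ?mulr1n ?mulr0n !hornerE.
Qed.

Lemma resolventE M z : ~~ eigenvalue M z ->
  invmx (z%:M - M) = \matrix_(i, j) resolvent M i j z.
Proof.
rewrite eigenvalue_root_char => zM.
have dE : \det (z%:M - M) = (char_poly M).[z].
  by rewrite -horner_char_poly_mx det_map_mx.
rewrite /invmx unitmxE dE unitfE zM -horner_char_poly_mx -map_mx_adj.
by apply/matrixP => i j; rewrite [RHS]mxE [LHS]mxE [X in _ * X]mxE.
Qed.

Lemma cauchy_mxE m (Gamma : 'I_m -> R -> Cplx R) M i j :
  closed_contour Gamma ->
  (forall w, on_trace Gamma w -> ~~ eigenvalue M w) ->
  cauchy_mx f M Gamma i j = (two_i_pi R)^-1 *
    contour_integral (fun z => f z * resolvent M i j z) Gamma.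
Proof.
move=> CG nS; rewrite !mxE; congr (_ * _); apply: eq_contour_integral => w /nS wS.
by rewrite resolventE// mxE.
Qed.

(** [f(M)] commutes with [M]. *)
Lemma mxfun_comm M Y : is_mxfun Omega f M Y -> comm_mx Y M.
Proof.
move=> [m [Gamma [[CG GO _ _] <-]]].
have TO w : on_trace Gamma w -> Omega w by move=> [j [t [t01 ->]]]; case: (GO j t t01).
have nS w : on_trace Gamma w -> ~~ eigenvalue M w.
  by move=> [j [t [t01 ->]]]; case: (GO j t t01) => _ /negP.
have cf : cont_on Gamma f := cont_on_f TO fO.
have cR i j : cont_on Gamma (fun z => f z * resolvent M i j z).
  apply: (cont_onM cf) => w Tw; apply: cont_atM; last exact: cont_at_horner.
  apply: (cont_atV (f := fun z => (char_poly M).[z])).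
    by have := nS w Tw; rewrite eigenvalue_root_char.
  exact: cont_at_horner.
have E w : on_trace Gamma w ->
    (\matrix_(i, j) resolvent M i j w) *m M = M *m (\matrix_(i, j) resolvent M i j w).
  move=> /nS wS; rewrite -resolventE//.
  have u : w%:M - M \in unitmx.
    by move: wS; rewrite eigenvalue_root_char -horner_char_poly_mx unitmxE det_map_mx unitfE.
  have c : M *m (w%:M - M) = (w%:M - M) *m M.
    by rewrite mulmxBr mulmxBl scalar_mxC.
  by rewrite -[LHS](mulmxK u) -[_ *m M *m _]mulmxA c mulmxA mulVmx// mul1mx.
apply/matrixP => i k; rewrite !mxE.
under eq_bigr do
  rewrite cauchy_mxE// -mulrA [_ * M _ _]mulrC -(contour_integralZ CG _ (cR _ _)).
under [RHS]eq_bigr do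
  rewrite cauchy_mxE// mulrCA -(contour_integralZ CG _ (cR _ _)).
rewrite -!mulr_sumr; congr (_ * _).
rewrite -(contour_integral_sum CG _ (fun j => cont_onZ (c := M j k) (cR i j))).
rewrite -(contour_integral_sum CG _ (fun j => cont_onZ (c := M i j) (cR j k))).
apply: eq_contour_integral => w Tw; have /matrixP/(_ i k) := E w Tw; rewrite !mxE => Ew.
under eq_bigr => j _ do rewrite mulrCA [M j k * _]mulrC.
under [RHS]eq_bigr => j _ do rewrite mulrCA.
rewrite -!mulr_sumr; congr (_ * _).
have -> : \sum_j resolvent M i j w * M j k =
   \sum_j (\matrix_(i, j) resolvent M i j w) i j * M j k.
  by apply: eq_bigr => j _; rewrite mxE.
rewrite Ew; apply: eq_bigr => j _; by rewrite mxE.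
Qed.

End FunctionalCalculus.

(** At a nilpotent matrix the functional calculus is evaluation of the Taylor
    expansion at 0. *)
Lemma mxfun_nilpotent (R : realType) n (Omega : set (Cplx R)) f a C rho
    (M Y : 'M[Cplx R]_n.+1) :
  open Omega -> Omega 0 ->
  (forall z, Omega z -> exists a C rho, taylor f z a C rho) ->
  taylor f 0 a C rho -> M ^+ n.+1 = 0 -> is_mxfun Omega f M Y ->
  Y = \sum_(k < n.+1) a k *: M ^+ k.
Proof.
move=> oO O0 fO tf Mn [m [Gamma [[CG GO wS wO] <-]]].
have TO w : on_trace Gamma w -> Omega w by move=> [j [t [t01 ->]]]; case: (GO j t t01).
have S0 : spectrum M 0 by rewrite /spectrum /= (spectrum_nilpotent _ Mn).
have n0 w : on_trace Gamma w -> w != 0.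
  by move=> [j [t [t01 ->]]]; apply/eqP => E; case: (GO j t t01); rewrite E.
have nT0 : ~ on_trace Gamma 0 by move=> /n0/eqP.
have tpi0 : two_i_pi R != 0.
  by rewrite eq_complex /= mulf_eq0 pnatr_eq0 /= (gt_eqF (pi_gt0 R)) andbF.
have w0 : contour_integral (fun w => (w - 0)^-1) Gamma = two_i_pi R.
  have := wS 0 S0; rewrite /winding => E.
  by rewrite -[RHS]mulr1 -E mulrA mulfV// mul1r.
have wO' z : ~ Omega z -> contour_integral (fun w => (w - z)^-1) Gamma = 0.
  by move=> /wO; exact: winding0E.
have cf : cont_on Gamma f := cont_on_f TO fO.
have cF k : cont_on Gamma (fun w => f w * (w - 0)^-1 ^+ k.+1).
  exact (cont_onM cf (cont_on_subVX nT0)).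
apply/matrixP => i j; rewrite !mxE summxE.
rewrite (@eq_contour_integral _ _ _ _ (fun w => \sum_(k < n.+1) (M ^+ k) i j *
    (f w * (w - 0)^-1 ^+ k.+1))); last first.
  move=> w /n0 wn0; rewrite resolvent_nilpotent// summxE mulr_sumr.
  by apply: eq_bigr => k _; rewrite !mxE subr0; ring.
rewrite (contour_integral_sum CG _ (fun k : 'I_n.+1 => cont_onZ (c := (M ^+ k) i j) (cF k))).
rewrite mulr_sumr; apply: eq_bigr => k _.
rewrite (contour_integralZ CG _ (cF k)) (cauchy_formula CG oO TO wO' fO k O0 nT0 tf) w0 mxE.
have : (two_i_pi R)^-1 * two_i_pi R = 1 by rewrite mulVf.
set c := two_i_pi R => cc.
by rewrite [a k * c]mulrC mulrCA [c^-1 * _]mulrA cc mul1r mulrC.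
Qed.

(** * Rational expressions and the theorem *)

(* Ring structures of multivariate polynomials, without their notations. *)
Import (canonicals) mpoly.

Section RationalExpressions.
Variables (R : realType) (m : nat).

(** The Taylor coefficient [f^(i+1)(0) / (i+1)!] as a polynomial in the derivatives:
    the indeterminate of index [i] stands for [f^(i+1)(0)]. *)
Definition generic_coef (i : 'I_m.+1) : mpoly.mpoly m.+1 rat :=
  mpoly.mpolyC m.+1 ((i.+1`!)%:R^-1) * mpoly.mpolyX rat (mpoly.mnm1 i).

(** Numerators and common denominator of the derivatives of the compositional
    inverse.  The factor [(k+1)!] turns Taylor coefficients into derivatives. *)
Definition inv_num (k : 'I_m.+1) : mpoly.mpoly m.+1 rat :=
  (k.+1`!)%:R * (\adj (power_mx generic_coef)) k ord0.

Definition inv_den : mpoly.mpoly m.+1 rat := \det (power_mx generic_coef).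

Variable x : 'I_m.+1 -> Cplx R.
Let a i : Cplx R := x i / (i.+1`!)%:R.
Let ev : {rmorphism mpoly.mpoly m.+1 rat -> Cplx R} := mpoly.mmap (@ratr (Cplx R)) x.

Lemma eval_generic_coef : ev \o generic_coef = a.
Proof.
apply/funext => i; rewrite /= rmorphM /= [X in X * _]mpoly.mmapC.
rewrite [X in _ * X]mpoly.mmapX mpoly.mmap1U /a mulrC; congr (_ * _).
by rewrite /= fmorphV rmorph_nat.
Qed.

Lemma eval_inv_den : eval_rat x inv_den = \det (power_mx a).
Proof.
by rewrite -[LHS]/(ev _) /inv_den -det_map_mx map_power_mx eval_generic_coef.
Qed.

Lemma eval_inv_num k : eval_rat x (inv_num k) =
  (k.+1`!)%:R * (\adj (power_mx a)) k ord0.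
Proof.
rewrite -[LHS]/(ev _) /inv_num rmorphM rmorph_nat; congr (_ * _).
rewrite -eval_generic_coef -map_power_mx -map_mx_adj.
by rewrite [RHS]mxE.
Qed.

End RationalExpressions.

Lemma coef_spoly (F : comNzRingType) m (a : 'I_m -> F) (k : 'I_m) :
  (spoly a)`_k.+1 = a k.
Proof.
rewrite /spoly coef_sum (bigD1 k)//= big1 => [|i ik]; rewrite coefZ coefXn.
  by rewrite eqxx mulr1 addr0.
by rewrite eqSS eq_sym (negbTE (ik : val i != val k)) mulr0.
Qed.

Unset Implicit Arguments.

(* The rational expressions P k / Q k are chosen before Omega, f, A and X: they
   depend on n (and k) only.  The variable of index i stands for f^(i+1)(0). *)
Theorem proposition5 (R : realType) (n : nat) (hn : (2 <= n)%N) :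
  exists P Q : 'I_n.-1 -> mpoly.mpoly n.-1 rat,
  forall (Omega : set (Cplx R)) (f : Cplx R -> Cplx R) (A X : 'M[Cplx R]_n),
    open Omega -> connected Omega -> Omega 0 ->
    analytic_on Omega f ->
    spectrum (X *m A - A *m X) `<=` Omega ->
    is_mxfun Omega f (X *m A - A *m X) X ->
  exists N : 'M[Cplx R]_n,
  [/\ nilpotent_mx N,
      X = (f 0)%:M + N,
      nilpotent_mx (N *m A - A *m N),
      \sum_(1 <= k < n)
        (derive1n k f 0 / (k`!)%:R) *: (N *m A - A *m N) ^+ k = N &
      derive1 f 0 != 0 ->
      exists (c : Cplx R) (r : R) (g : Cplx R -> Cplx R),
      [/\ 0 < r /\ ball c r%:C (f 0),
          analytic_on (ball c r%:C) g,
          derive1 g (f 0) != 0,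
          N *m A - A *m N =
            \sum_(1 <= k < n) (derive1n k g (f 0) / (k`!)%:R) *: N ^+ k &
          forall k : 'I_n.-1,
            let df := fun i : 'I_n.-1 => derive1n i.+1 f 0 in
            eval_rat df (Q k) != 0 /\
            derive1n k.+1 g (f 0) = eval_rat df (P k) / eval_rat df (Q k)]].
Proof.
case: n hn => [|[|m]] // _.
exists (@inv_num m), (fun=> inv_den m) => Omega f A X oO _ O0 fan _ fBX.
set B := X *m A - A *m X in fBX.
have fO z : Omega z -> exists a C rho, taylor f z a C rho.
  by move=> /fan; exact: analytic_taylor.
have [a [C [rho tf]]] := fO 0 O0.
have [k Bk] : exists k, B ^+ k = 0.
  apply: (jacobson_nilpotent (A := A) (X := X) (pchar_num _)) => //.
  exact (mxfun_comm fO fBX).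
have Bn := nilpotent_mx_order Bk.
have XE := mxfun_nilpotent oO O0 fO tf Bn fBX.
have dfE j : derive1n j f 0 = (j`!)%:R * a j := taylor_derive1n oO fO j O0 tf.
have fact0 j : (j`!)%:R != 0 :> Cplx R by rewrite pnatr_eq0 -lt0n fact_gt0.
pose a' (i : 'I_m.+1) : Cplx R := a i.+1.
pose N := \sum_(i < m.+1) a' i *: B ^+ i.+1.
have XN : X = (f 0)%:M + N.
  rewrite {1}XE big_ord_recl /= expr0 (taylor_at tf) -scalemx1; congr (_ + _).
(* N differs from X by a scalar matrix *)
have NB : N *m A - A *m N = B.
  have -> : N = X - (f 0)%:M by rewrite XN addrAC subrr add0r.
  by rewrite mulmxBl mulmxBr scalar_mxC opprB addrA subrK.
have NE : N = horner_mx B (spoly a').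
  rewrite /spoly rmorph_sum; apply: eq_bigr => i _ /=.
  by rewrite linearZ /= rmorphXn /= horner_mx_X.
exists N; split=> //.
- exists m.+2; have [q E _] := spolyE a'.
  by rewrite NE E -rmorphXn exprMn rmorphM rmorphXn /= horner_mx_X Bn mul0r.
- by exists k; rewrite NB.
- rewrite big_add1 big_mkord NB; apply: eq_bigr => i _.
  by rewrite dfE mulrC mulKf.
have -> : derive1 f 0 = a 1%N by exact: taylor_derive1 tf.
move=> a10.
pose b := inv_coef a'.
(* the truncated compositional inverse of f, recentred at f 0 *)
pose g w := (spoly b).[w - f 0].
have [Cg tg] := horner_taylor (spoly b) (f 0).
have gE (j : 'I_m.+1) : derive1n j.+1 g (f 0) = (j.+1`!)%:R * b j.
  rewrite (taylor_derive1n openT _ j.+1 Logic.I tg) ?coef_spoly// => z _.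
  exact: horner_taylor_everywhere.
exists (f 0), 1, g; split.
- by split=> //; apply: ballxx; rewrite ltcR.
- move=> z _; have [c [D [r t]]] := horner_taylor_everywhere (spoly b) (f 0) z.
  exact: taylor_analytic t.
- by rewrite -derive1n1 (gE ord0) mulf_neq0// inv_coef0.
- rewrite big_add1 big_mkord NB {1}(power_inversion (a := a') a10 Bn).
  apply: eq_bigr => i _; by rewrite (gE i) mulrC mulKf.
move=> j df; rewrite eval_inv_den eval_inv_num.
have -> : (fun i : 'I_m.+1 => df i / (i.+1`!)%:R) = a'.
  by apply/funext => i; rewrite /df dfE mulrC mulKf.
by rewrite det_power_mx// gE mulrA.
Qed.
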